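(* Let $A$ be a fixed apartment of an affine building $X$. Fix an origin $0$ and fundamental Weyl chamber $C_f$ in $A$. Let $\rho:X\to A$ be the retraction onto $A$ centered at $\partial C_f^{\mathrm{op}}$. Let $x$ be a special vertex in $A$, let $x^+$ be the unique element of $W.x$ contained in $C_f$, and let $t$ be the type of a fixed minimal gallery $0\rightsquigarrow x^+$. If $\gamma\subset A$ is a positively folded gallery with source $0$ of type $t$, then $\gamma$ has a pre-image under $\rho$ (extended to galleries of $X$) which is a minimal gallery starting at $0$.
   Context: Root system and Coxeter complex. $V$ is a real vector space and $R\subset V$ an irreducible root system: $R$ is finite, $0\notin R$, $R$ generates $V$, for each $\alpha\in R$ there is $\alpha^\vee\in V^*$ with $\langle\alpha,\alpha^\vee\rangle=2$ such that the reflection $v\mapsto v-\langle v,\alpha^\vee\rangle\alpha$ leaves $R$ invariant, and $\alpha^\vee(R)\subset\mathbb{Z}$. $B=\{\alpha_i\}_{i\in I}$ is a basis of $R$. $E$ is the affine space underlying $V$. Hyperplanes are $H_{\alpha,k}=\{v\in E:\langle v,\alpha^\vee\rangle=k\}$, $\alpha\in R$, $k\in\mathbb{Z}$; each determines two closed half apartments. $W^a$ is the affine Weyl group, and the spherical Weyl group $W$ is identified with the stabilizer of $0$ in $W^a$. Alcoves are closures of connected components of $E\setminus\bigcup_{\alpha,k}H_{\alpha,k}$. A vertex is special if every hyperplane is parallel to a hyperplane through it. Weyl chambers are the $W^a$-translates of closures of connected components of $E\setminus\bigcup_{\alpha\in R}H_{\alpha,0}$. The fundamental Weyl chamber is $C_f=\{v\in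 E:\langle v,\alpha_i^\vee\rangle\ge 0\ \forall i\in I\}$, and $C_f^{\mathrm{op}}$ is the Weyl chamber opposite to $C_f$ in $A$. Building. $X$ is an (irreducible, simplicial) affine building with an apartment system, with associated root system $R$; its apartments are isomorphic to the Coxeter complex $E$ of $W^a$, and $A$ is identified with $E$, the origin $0$ being a special vertex. Simplices of $X$ carry the usual types. The parallel class $\partial S$ of a Weyl chamber $S$ is a chamber of the spherical building $\partial X$ at infinity. The retraction $\rho=\rho_{A,C_f^{\mathrm{op}}}:X\to A$ is the unique distance diminishing map whose restriction to each apartment $B$ containing a sub-Weyl chamber of $C_f^{\mathrm{op}}$ is an isomorphism onto $A$ fixing $A\cap B$ pointwise. Galleries. A (combinatorial) gallery in $X$ is a sequence $\gamma=(c_0',c_0,c_1',c_1,\ldots,c_n',c_n,c_{n+1}')$ in which the $c_i$ are alcoves, the source $c_0'$ is a vertex of $c_0$, the target $c_{n+1}'$ is a vertex of $c_n$, and $c_i'$ is a codimension one face of $c_{i-1}$ and $c_i$ for $1\le i\le n$ (repetitions $c_{i-1}=c_i$ are allowed). Its type is the list $(t_0,t_1,\ldots,t_n)$ of the types $t_i$ of the faces $c_i'$. It is minimal if it is a shortest gallery with source $c_0'$ and target $c_{n+1}'$; $\gamma:a\rightsquigarrow b$ means that $\gamma$ has source $a$ and target $b$. A hyperplane $H$ in $A$ separates an alcove $d$ and a Weyl chamber $S$ of $A$ if there is a representative $S'$ of $\partial S$ in $A$ such that $S'$ and $d$ are contained in different half apartments determined by $H$. A gallery is positively folded at $i$ if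 $c_i=c_{i-1}$ and the hyperplane $H=\mathrm{span}(c_i')$ separates $c_i$ and $C_f^{\mathrm{op}}$; it is positively folded if it is positively folded at $i$ whenever $c_{i-1}=c_i$.
   Formalization: The building X is assumed thick (for X = A a positively folded gallery with a fold has no minimal pre-image), and ''of type t'' also requires the target of γ to have the same type as x⁺ (otherwise the claim fails already in a thick tree). *)

(* Defs.v *)
From HB Require Import structures.
From mathcomp Require Import all_boot all_order all_algebra finmap.
From mathcomp Require Import all_classical all_reals all_analysis.

Set Implicit Arguments.
Unset Strict Implicit.
Unset Printing Implicit Defensive.

Import Order.TTheory GRing.Theory Num.Theory.
Import numFieldNormedType.Exports.

Local Open Scope classical_set_scope.
Local Open Scope ring_scope.

(* V = 'rV[R]_n, and V^* is identified with 'cV[R]_n through this pairing. *)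
Definition pairing (R : realType) (n : nat) (v : 'rV[R]_n) (f : 'cV[R]_n) : R :=
  (v *m f) 0 0.

(* The coroot of a root is determined by the axioms; the values of [coroot]
   outside [roots] are irrelevant. Root systems need not be reduced. *)
Record root_system (R : realType) (n : nat) := RootSystem {
  roots : {fset 'rV[R]_n};
  coroot : 'rV[R]_n -> 'cV[R]_n;
  roots_neq0 : 0 \notin roots;
  roots_span : <<enum_fset roots>>%VS = fullv;
  pairing_coroot : forall a, a \in roots -> pairing a (coroot a) = 2;
  roots_reflection : forall a b, a \in roots -> b \in roots ->
    b - pairing b (coroot a) *: a \in roots;
  coroot_int : forall a b, a \in roots -> b \in roots ->
    pairing b (coroot a) \is a Num.int
}.

Section CoxeterComplex.
Variables (R : realType) (n : nat) (phi : root_system R n).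
Local Notation V := 'rV[R]_n.

Definition irreducible_root_system : Prop :=
  roots phi != fset0 /\
  forall P Q : {fset V}, roots phi = (P `|` Q)%fset ->
    (forall a b, a \in P -> b \in Q -> pairing a (coroot phi b) = 0) ->
    P = fset0 \/ Q = fset0.

Definition root_basis (alpha : n.-tuple V) : Prop :=
  [/\ basis_of fullv alpha,
      forall i, tnth alpha i \in roots phi
    & forall b, b \in roots phi -> exists m : 'I_n -> nat,
        b = \sum_i tnth alpha i *+ m i \/ b = - \sum_i tnth alpha i *+ m i].

Definition hyperplane (a : V) (k : int) : set V :=
  [set v | pairing v (coroot phi a) = k%:~R].

Definition half_ge (a : V) (k : int) : set V :=
  [set v | k%:~R <= pairing v (coroot phi a)].

Definition half_le (a : V) (k : int) : set V :=
  [set v | pairing v (coroot phi a) <= k%:~R].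

Definition is_wall (H : set V) : Prop :=
  exists a k, a \in roots phi /\ H = hyperplane a k.

Definition affine_reflection (a : V) (k : int) (v : V) : V :=
  v - (pairing v (coroot phi a) - k%:~R) *: a.

(* Reflections are involutions, so closure under left multiplication by the
   generators already gives the generated group. *)
Inductive affine_weyl : (V -> V) -> Prop :=
| affine_weyl_id : affine_weyl id
| affine_weyl_refl a k w : a \in roots phi -> affine_weyl w ->
    affine_weyl (affine_reflection a k \o w).

Definition spherical_weyl (w : V -> V) : Prop := affine_weyl w /\ w 0 = 0.

Definition affine_regular : set V :=
  [set v | forall a k, a \in roots phi -> ~ hyperplane a k v].

Definition linear_regular : set V :=
  [set v | forall a, a \in roots phi -> ~ hyperplane a 0 v].

Definition alcove (c : set V) : Prop :=
  exists2 v, affine_regular v & c = closure (connected_component affine_regular v).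

(* The vertices are the zero-dimensional facets of the arrangement. *)
Definition is_vertex (p : V) : Prop :=
  forall q, (forall a k, a \in roots phi -> hyperplane a k p -> hyperplane a k q) ->
    q = p.

Definition parallel_hyperplanes (H H' : set V) : Prop :=
  exists u : V, H' = [set v + u | v in H].

Definition special_vertex (x : V) : Prop :=
  is_vertex x /\
  forall H, is_wall H -> exists H', [/\ is_wall H', H' x & parallel_hyperplanes H H'].

Definition weyl_chamber (C : set V) : Prop :=
  exists w v, [/\ affine_weyl w, linear_regular v
    & C = w @` closure (connected_component linear_regular v)].

(* [parallel_chambers S S'] means that S and S' define the same chamber at
   infinity. *)
Definition parallel_chambers (S S' : set V) : Prop :=
  exists T, [/\ weyl_chamber T, T `<=` S & T `<=` S'].

Definition fundamental_chamber (alpha : n.-tuple V) : set V :=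
  [set v | forall i, 0 <= pairing v (coroot phi (tnth alpha i))].

Definition opposite_chamber (alpha : n.-tuple V) : set V :=
  [set - v | v in fundamental_chamber alpha].

(* Since alcoves are convex hulls of their vertices and half apartments are
   convex, d may be given by the set of vertices of an alcove. *)
Definition separates (H d S : set V) : Prop :=
  exists S' a k,
    [/\ weyl_chamber S', parallel_chambers S' S, a \in roots phi,
        H = hyperplane a k
      & (S' `<=` half_ge a k /\ d `<=` half_le a k) \/
        (S' `<=` half_le a k /\ d `<=` half_ge a k)].

Definition affine_span (A : set V) : set V :=
  [set v | exists m (p : 'I_m -> V) (t : 'I_m -> R),
    [/\ forall i, A (p i), \sum_i t i = 1 & v = \sum_i t i *: p i]].

(* The Weyl-invariant Euclidean distance; for irreducible phi it is unique up to
   a scalar factor. *)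
Definition edist (u v : V) : R :=
  Num.sqrt (\sum_(a <- enum_fset (roots phi)) pairing (u - v) (coroot phi a) ^+ 2).

(* The Coxeter complex of the affine Weyl group as an abstract simplicial
   complex: a face of an alcove is given by the set of its vertices. *)
Definition coxeter_complex : set (set V) :=
  [set s | exists2 c, alcove c & s `<=` c `&` is_vertex].

End CoxeterComplex.

Section Complexes.
Variables (P Q : Type).

Definition vertices (K : set (set P)) : set P := [set p | K [set p]].

Definition subsimplex_closed (K : set (set P)) : Prop :=
  forall s t, K s -> t `<=` s -> K t.

Definition chamber (K : set (set P)) (c : set P) : Prop :=
  K c /\ forall s, K s -> c `<=` s -> s = c.

Definition panel_of (c s : set P) : Prop := exists2 p, c p & s = c `\ p.

Definition subcomplex_in (K : set (set P)) (C : set P) : set (set P) :=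
  [set s | K s /\ s `<=` C].

Definition image_complex (f : P -> Q) (K : set (set P)) : set (set Q) :=
  [set f @` s | s in K].

Definition complex_iso (K : set (set P)) (L : set (set Q)) (f : P -> Q) : Prop :=
  set_inj (vertices K) f /\ L = image_complex f K.

(* A labelling of the vertices by types; the type of a simplex s is then the set
   tau @` s. *)
Definition labelling (K : set (set P)) (T : Type) (tau : P -> T) : Prop :=
  forall c, chamber K c -> set_bij c [set: T] tau.

End Complexes.

Section Sectors.
Variables (R : realType) (n : nat) (phi : root_system R n) (P : Type).

(* The Weyl chambers of a simplicial complex covered by a family of apartments,
   as subcomplexes. *)
Definition sector (apts : set (set (set P))) (S : set (set P)) : Prop :=
  exists B f C, [/\ apts B, complex_iso (coxeter_complex phi) B f, weyl_chamber phi C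
    & S = image_complex f (subcomplex_in (coxeter_complex phi) C)].

End Sectors.

(* Thick affine buildings with an apartment system. The first group of axioms is
   that of a simplicial complex, the second the usual building axioms (with
   thickness). The last group concerns infinity: the parallel classes of Weyl
   chambers form a spherical building, and X is covered by the apartments
   containing a sub-Weyl chamber of a given Weyl chamber, so that retractions
   centered at chambers at infinity are defined on all of X. *)
Record affine_building (R : realType) (n : nat) (phi : root_system R n) :=
  AffineBuilding {
  bpoint : Type;
  bsimplex : set (set bpoint);
  apartment : set (set (set bpoint));

  bsimplex_down : subsimplex_closed bsimplex;
  bsimplex_vertex : forall p, bsimplex [set p];

  apartment_sub : forall B, apartment B -> B `<=` bsimplex;
  apartment_coxeter : forall B, apartment B ->
    exists f, complex_iso (coxeter_complex phi) B f;
  apartment_exists : forall s t, bsimplex s -> bsimplex t ->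
    exists B, [/\ apartment B, B s & B t];
  apartment_iso : forall B B' s t, apartment B -> apartment B' ->
    B s -> B' s -> B t -> B' t ->
    exists f, [/\ complex_iso B B' f,
                  forall p, s p -> f p = p & forall p, t p -> f p = p];
  building_thick : forall c s, chamber bsimplex c -> panel_of c s ->
    exists c1 c2, [/\ chamber bsimplex c1 /\ panel_of c1 s,
                      chamber bsimplex c2 /\ panel_of c2 s
                    & [/\ c1 <> c, c2 <> c & c1 <> c2]];

  sectors_common_apartment : forall S S',
    sector phi apartment S -> sector phi apartment S' ->
    exists B T T', [/\ apartment B,
      [/\ sector phi apartment T, T `<=` S & T `<=` B]
    & [/\ sector phi apartment T', T' `<=` S' & T' `<=` B]];
  chamber_sector_apartment : forall c S,
    chamber bsimplex c -> sector phi apartment S ->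
    exists B T, [/\ apartment B, B c
      & [/\ sector phi apartment T, T `<=` S & T `<=` B]]
}.

Section Retraction.
Variables (R : realType) (n : nat) (phi : root_system R n)
  (X : affine_building phi).
Local Notation V := 'rV[R]_n.
Local Notation E := (coxeter_complex phi).

(* The apartment A is identified with E by the isomorphism iota, and rho is the
   retraction onto A, with values in E, centered at the chamber at infinity
   determined by the Weyl chamber C of E. It is given by its effect on vertices;
   distances in an apartment of X are measured in E via any chart f. *)
Definition retraction_at_infinity (A : set (set (bpoint X))) (iota : V -> bpoint X)
    (C : set V) (rho : bpoint X -> V) : Prop :=
  (forall B f u v, apartment B -> complex_iso E B f ->
     vertices E u -> vertices E v ->
     edist phi (rho (f u)) (rho (f v)) <= edist phi u v) /\
  (forall B S, apartment B -> sector phi (@apartment _ _ _ X) S ->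
     S `<=` image_complex iota (subcomplex_in E C) -> S `<=` B ->
     complex_iso B E rho /\
     forall v, vertices E v -> vertices B (iota v) -> rho (iota v) = v).

End Retraction.

(* The gallery (c'_0, c_0, c'_1, c_1, ..., c'_m, c_m, c'_(m+1)) is given by its
   source c'_0, the alcove c_0, the sequence of the pairs (c'_i, c_i) for
   1 <= i <= m, and its target c'_(m+1). *)
Record gallery (P : Type) := Gallery {
  gsource : P;
  ghead : set P;
  gsteps : seq (set P * set P);
  gtarget : P
}.

Section Galleries.
Variables (P : Type).

Definition galcove (g : gallery P) (i : nat) : set P :=
  nth set0 (ghead g :: unzip2 (gsteps g)) i.

(* [gpanel g i] is c'_(i+1), the common face of c_i and c_(i+1). *)
Definition gpanel (g : gallery P) (i : nat) : set P :=
  nth set0 (unzip1 (gsteps g)) i.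

Definition glength (g : gallery P) : nat := size (gsteps g).

Definition is_gallery (K : set (set P)) (g : gallery P) : Prop :=
  [/\ forall i, (i <= glength g)%N -> chamber K (galcove g i),
      galcove g 0 (gsource g),
      galcove g (glength g) (gtarget g)
    & forall i, (i < glength g)%N ->
        panel_of (galcove g i) (gpanel g i) /\
        panel_of (galcove g i.+1) (gpanel g i)].

Definition minimal_gallery (K : set (set P)) (g : gallery P) : Prop :=
  is_gallery K g /\
  forall g', is_gallery K g' -> gsource g' = gsource g -> gtarget g' = gtarget g ->
    (glength g <= glength g')%N.

(* The list of the types of c'_0, ..., c'_m; the target does not contribute. *)
Definition gtype (T : Type) (tau : P -> T) (g : gallery P) : seq (set T) :=
  tau @` [set gsource g] :: [seq tau @` s | s <- unzip1 (gsteps g)].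

Definition gallery_map (Q : Type) (f : P -> Q) (g : gallery P) : gallery Q :=
  Gallery (f (gsource g)) (f @` ghead g)
    [seq (f @` s.1, f @` s.2) | s <- gsteps g] (f (gtarget g)).

End Galleries.

Definition positively_folded_at (R : realType) (n : nat) (phi : root_system R n)
    (C : set 'rV[R]_n) (g : gallery 'rV[R]_n) (i : nat) : Prop :=
  galcove g i.+1 = galcove g i /\
  separates phi (affine_span (gpanel g i)) (galcove g i.+1) C.

Definition positively_folded (R : realType) (n : nat) (phi : root_system R n)
    (C : set 'rV[R]_n) (g : gallery 'rV[R]_n) : Prop :=
  forall i, (i < glength g)%N -> galcove g i.+1 = galcove g i ->
    positively_folded_at phi C g i.

(* Main.v *)
Require Import Defs.
From HB Require Import structures.
From mathcomp Require Import all_boot all_order all_algebra finmap.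
From mathcomp Require Import all_classical all_reals all_analysis.
From mathcomp Require Import lra ring zify.

Set Implicit Arguments.
Unset Strict Implicit.
Unset Printing Implicit Defensive.

Import Order.TTheory GRing.Theory Num.Theory.
Import numFieldNormedType.Exports.

Local Open Scope classical_set_scope.
Local Open Scope ring_scope.

(** A gallery of X of the same type as the minimal gallery delta that never
    stutters is minimal: the retraction centered at its first alcove maps it onto
    the copy of delta in an apartment, because a first fold would yield a gallery
    shorter than delta with the same ends. It therefore suffices to lift gamma
    alcove by alcove to a gallery that does not stutter. If c_i differs from
    c_(i-1), the lift of c_i is found in an apartment containing the lift of
    c_(i-1) and a subsector of the chamber at infinity. If gamma is folded at i,
    then c_i lies on the far side of the wall through c'_i; exactly one of the
    alcoves of X on the lifted panel is retracted to the near side, and by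
    thickness there are two others.

    The affine Weyl group is not needed. That a panel of E lies in at least two
    alcoves, and that type-preserving charts carry any alcove of E to any alcove
    of X, is derived from thickness; the distance between two alcoves of E is the
    number of walls separating them. *)

(** Nothing is known beforehand about the shape of alcoves: a panel is only the vertex set of an
    alcove with one vertex removed, and it might lie on no wall. A second alcove on the panel
    settles this, since a wall separating two alcoves contains their common vertices; such walls,
    one opposite each vertex, supply barycentric coordinates. Walls are handled as sets because
    opposite or proportional roots can define the same hyperplane, and distance must count each wall
    once.

    The gallery delta need not lie in A, and its first alcove is in general not that of gamma. It is
    therefore moved into E by a retraction from its first alcove, and compared with the lift through
    a chart of the same types that sends this alcove to the first alcove of the lift. In E, a
    non-stuttering gallery is determined by its first alcove and its types: a type selects the panel
    of the current alcove, and thinness leaves one other alcove on it. The list of types omits the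
    target, so the type of the target is carried along separately to identify the last vertex. *)

Local Notation roots := Defs.roots.

(** * Elementary estimates over the reals *)

Section Preliminaries.
Variable R : realType.

(** Typical use: [x] and [y] are the heights over a wall of two points that it separates, and [z]
    that of a vertex common to their alcoves, which therefore lies on the wall. *)
Lemma between_eq0 (x y z : R) : x * y < 0 -> 0 <= x * z -> 0 <= y * z -> z = 0.
Proof.
move=> xy xz yz; apply/eqP; rewrite -sqrf_eq0 eq_le sqr_ge0 andbT.
have : 0 <= (x * y) * z ^+ 2.
  have -> : x * y * z ^+ 2 = (x * z) * (y * z) by ring.
  exact: mulr_ge0.
by rewrite nmulr_rge0.
Qed.

Lemma convex_gt0 (s p q : R) : 0 <= s -> s <= 1 -> 0 < p -> 0 < q ->
  0 < (1 - s) * p + s * q.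
Proof.
move=> s0 s1 p0 q0; have [->|s_lt1] := eqVneq s 1; first by rewrite subrr; lra.
have s1' : 0 < 1 - s by rewrite subr_gt0 lt_neqAle s_lt1.
by rewrite ltr_pwDl ?mulr_gt0 // mulr_ge0 // ltW.
Qed.

Lemma count_sub (I : eqType) (P Q : pred I) (s : seq I) (i : I) :
  {in s, subpred P Q} -> i \in s -> Q i -> ~~ P i -> (count P s < count Q s)%N.
Proof.
elim: s => //= j s IH PQ.
have le_PQ : (count P s <= count Q s)%N.
  have -> : count P s = count (predI P [in s]) s.
    by apply: eq_in_count => x xs /=; rewrite xs andbT.
  apply: sub_count => x /= /andP[Px xs]; apply: PQ Px.
  by rewrite in_cons xs orbT.
rewrite in_cons => /orP[/eqP -> Qj /negbTE ->|is_ Qi nPi].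
  by rewrite Qj add0n add1n ltnS.
have lt_PQ : (count P s < count Q s)%N.
  by apply: IH => // x xs; apply: PQ; rewrite in_cons xs orbT.
have : (P j <= Q j)%N.
  by case E: (P j) => //; rewrite (PQ j _ E) // mem_head.
by move=> h; rewrite -addnS leq_add.
Qed.

Lemma seq_argmin (I : eqType) (s : seq I) (F : I -> R) i : i \in s ->
  exists2 j, j \in s & forall i, i \in s -> F j <= F i.
Proof.
elim: s i => // j s IH i _; case: s IH => [|j' s] IH.
  by exists j; rewrite ?mem_head // => i'; rewrite inE => /eqP ->.
have [m ms hm] := IH j' (mem_head _ _).
have [jm|mj] := leP (F j) (F m).
  exists j; first exact: mem_head.
  by move=> i'; rewrite in_cons => /orP[/eqP->//|/hm]; exact: le_trans.
exists m; first by rewrite in_cons ms orbT.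
by move=> i'; rewrite in_cons => /orP[/eqP->|/hm//]; exact: ltW.
Qed.

Lemma near_right_affine (p q : R) : 0 < p -> \forall t \near 0^'+, 0 < p + t * q.
Proof.
move=> p0; have q1 : 0 < `|q| + 1 by rewrite ltr_wpDl.
have d : 0 < p / (`|q| + 1) by rewrite divr_gt0.
near=> t.
have t0 : 0 < t by near: t; exact: nbhs_right_gt.
have : t < p / (`|q| + 1) by near: t; exact: nbhs_right_lt.
rewrite ltr_pdivlMr // => tp.
have : - `|q| <= q by rewrite lerNl -normrN ler_norm.
nra.
Unshelve. all: by end_near. Qed.

Lemma near_right_all (I : eqType) (s : seq I) (P : I -> R -> Prop) :
  (forall i, i \in s -> \forall t \near 0^'+, P i t) ->
  \forall t \near (0 : R)^'+, forall i, i \in s -> P i t.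
Proof.
elim: s => [|i s IH] h; first by apply: nearW => t i; rewrite in_nil.
have {}IH : \forall t \near 0^'+, forall j, j \in s -> P j t.
  by apply: IH => j js; apply: h; rewrite in_cons js orbT.
have hi := h i (mem_head _ _).
near=> t => j; rewrite in_cons => /orP[/eqP->|js].
  by near: t.
by move: j js; near: t.
Unshelve. all: by end_near. Qed.

(** For positive [m] the next integer to the right of [y] is [floor y + 1], at positive distance
    even if [y] is an integer; a small step stops before it. *)
Lemma near_right_not_int (y m : R) : m != 0 ->
  \forall s \near 0^'+, y + s * m \isn't a Num.int.
Proof.
wlog m0 : y m / 0 < m => [W|_].
  rewrite neq_lt => /orP[m0|m0]; last by apply: W => //; rewrite gt_eqF.
  have : \forall s \near (0 : R)^'+, - y + s * - m \isn't a Num.int.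
    by apply: W; rewrite ?oppr_gt0 // oppr_eq0 lt_eqF.
  by apply: filterS => s; rewrite mulrN -opprD rpredN.
have : \forall s \near (0 : R)^'+, 0 < (Num.floor y + 1)%:~R - y + s * - m.
  by apply: near_right_affine; rewrite subr_gt0 floorD1_gt.
apply: filterS2 (nbhs_right_gt 0) => s h s0.
rewrite intrEfloor (@floor_def _ _ (Num.floor y)).
  apply/eqP => E; have := floor_le y; have : 0 < s * m by rewrite mulr_gt0.
  by rewrite E; lra.
apply/andP; split; last by lra.
by apply: le_trans (floor_le y) _; rewrite lerDl mulr_ge0 // ltW.
Qed.

End Preliminaries.

(** * Bilinearity and continuity of the pairing *)

Section Pairing.
Variables (R : realType) (n : nat).
Implicit Types (u v : 'rV[R]_n) (f g : 'cV[R]_n).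

Lemma pairingDl u v f : pairing (u + v) f = pairing u f + pairing v f.
Proof. by rewrite /pairing mulmxDl mxE. Qed.

Lemma pairingZl t v f : pairing (t *: v) f = t * pairing v f.
Proof. by rewrite /pairing -scalemxAl mxE. Qed.

Lemma pairingNl v f : pairing (- v) f = - pairing v f.
Proof. by rewrite /pairing mulNmx mxE. Qed.

Lemma pairingBl u v f : pairing (u - v) f = pairing u f - pairing v f.
Proof. by rewrite pairingDl pairingNl. Qed.

Lemma pairing_sum (I : Type) (s : seq I) (F : I -> 'rV[R]_n) f :
  pairing (\sum_(i <- s) F i) f = \sum_(i <- s) pairing (F i) f.
Proof.
elim: s => [|i s IH]; first by rewrite !big_nil /pairing mul0mx mxE.
by rewrite !big_cons pairingDl IH.
Qed.

Lemma pairingDr v f g : pairing v (f + g) = pairing v f + pairing v g.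
Proof. by rewrite /pairing mulmxDr mxE. Qed.

Lemma pairingZr t v f : pairing v (t *: f) = t * pairing v f.
Proof. by rewrite /pairing -scalemxAr mxE. Qed.

Lemma pairingNr v f : pairing v (- f) = - pairing v f.
Proof. by rewrite -scaleN1r pairingZr mulN1r. Qed.

Lemma pairing_sumr (I : Type) (s : seq I) (F : I -> 'cV[R]_n) v :
  pairing v (\sum_(i <- s) F i) = \sum_(i <- s) pairing v (F i).
Proof.
elim: s => [|i s IH]; first by rewrite !big_nil /pairing mulmx0 mxE.
by rewrite !big_cons pairingDr IH.
Qed.

Lemma pairing_inj v : (forall f, pairing v f = 0) -> v = 0.
Proof.
move=> h; apply/rowP => j; have := h (delta_mx j 0).
by rewrite /pairing -colE !mxE.
Qed.

Lemma pairing_injr f : (forall v, pairing v f = 0) -> f = 0.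
Proof.
move=> h; apply/colP => j; have := h (delta_mx 0 j).
by rewrite /pairing -rowE !mxE.
Qed.

Lemma pairing_continuous f : continuous (fun v => pairing v f).
Proof.
move=> v; rewrite /pairing.
have -> : (fun v : 'rV[R]_n => (v *m f) 0 0) =
          (fun v => \sum_(j < n) v 0 j * f j 0).
  by apply/funext => w; rewrite mxE.
apply: (@cvg_big R^o 'I_n +%R 0 xpredT _ _ (nbhs v) _ (fun j w => w 0 j * f j 0)
  (fun j => v 0 j * f j 0)) => [|j _].
  exact: add_continuous.
by apply: cvgM; [exact: coord_continuous|exact: cvg_cst].
Qed.

End Pairing.

(** * Connected components and linear inequalities *)

Section Topology.
Variables (R : realType) (n : nat).
Local Notation V := 'rV[R]_n.
Implicit Types (A : set V) (u v : V) (f : 'cV[R]_n) (k t : R).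

(** The pairing with [f] maps the component to an interval that omits [k]; the closed half-space
    containing the component then contains its closure. *)
Lemma component_ge A v f k : A v -> k < pairing v f ->
  (forall u, A u -> pairing u f != k) ->
  forall u, closure (connected_component A v) u -> k <= pairing u f.
Proof.
move=> Av kv Ak.
pose S := connected_component A v.
have Ssub : S `<=` [set u | k <= pairing u f].
  move=> u Su /=; rewrite leNgt; apply/negP => uk.
  have : is_interval [set pairing w f | w in S].
    apply/connected_intervalP; apply: connected_continuous_connected.
      exact: component_connected.
    by apply: continuous_subspaceT; exact: pairing_continuous.
  move=> /(_ (pairing u f) (pairing v f)) I.
  have [|||w Sw wk] := I _ _ k.
  - by exists u.
  - by exists v => //; exact: connected_component_refl.
  - by rewrite !ltW.
  by have := Ak w (connected_component_sub Sw); rewrite wk eqxx.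
have clo : closed [set u : V | k <= pairing u f].
  have -> : [set u : V | k <= pairing u f] = (fun u => pairing u f) @^-1` [set x | k <= x].
    by [].
  apply: preimage_closed; last exact: closed_ge.
  by move=> x _; exact: pairing_continuous.
move=> u /(closureS Ssub).
by rewrite -(closure_id _).1.
Qed.

Lemma component_le A v f k : A v -> pairing v f < k ->
  (forall u, A u -> pairing u f != k) ->
  forall u, closure (connected_component A v) u -> pairing u f <= k.
Proof.
move=> Av kv Ak u cu; rewrite -lerN2 -pairingNr.
apply: component_ge Av _ _ _ cu; first by rewrite pairingNr ltrN2.
by move=> w /Ak; rewrite pairingNr eqr_opp.
Qed.

Lemma pairing_segment u v t f :
  pairing (v + t *: (u - v)) f = (1 - t) * pairing v f + t * pairing u f.
Proof. by rewrite pairingDl pairingZl pairingBl; ring. Qed.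

Lemma segment_component A u v :
  (forall t, 0 <= t <= 1 -> A (v + t *: (u - v))) -> connected_component A v u.
Proof.
move=> h; pose g (t : R^o) : V := v + t *: (u - v).
apply: (@connected_component_max _ A (g @` `[0, 1])).
- by exists 0; rewrite /= ?in_itv /= ?lexx ?ler01 // /g scale0r addr0.
- by move=> _ [t /= t01 <-]; apply: h; rewrite in_itv in t01.
- apply: connected_continuous_connected; first exact: segment_connected.
  apply: continuous_subspaceT => t.
  by apply: cvgD; [exact: cvg_cst|apply: cvgZr_tmp; exact: cvg_id].
by exists 1; rewrite /= ?in_itv /= ?lexx ?ler01 // /g scale1r addrC subrK.
Qed.

Lemma segment_closure A u v :
  (forall t, 0 <= t < 1 -> A (v + t *: (u - v))) ->
  closure (connected_component A v) u.
Proof.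
move=> h B nB; have : \forall s \near 0^'+, B (u + s *: (v - u)) /\ 0 < s < 1.
  have cv : u + s *: (v - u) @[s --> (0 : R^o)^'+] --> u + 0 *: (v - u).
    apply: cvgD; first exact: cvg_cst.
    by apply: cvgZr_tmp; apply: cvg_at_right_filter; exact: cvg_id.
  rewrite scale0r addr0 in cv.
  near=> s; split; first by near: s; exact: cv.
  by apply/andP; split; near: s; [exact: nbhs_right_gt|exact: nbhs_right_lt].
move=> /filter_ex [s [Bs /andP[s0 s1]]].
exists (u + s *: (v - u)); split=> //.
apply: segment_component => t /andP[t0 t1].
have -> : v + t *: (u + s *: (v - u) - v) = v + (t * (1 - s)) *: (u - v).
  by apply/rowP => j; rewrite !mxE; ring.
by apply: h; nra.
Unshelve. all: by end_near. Qed.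

End Topology.

(** * Coroots as duals of the roots under an invariant form *)

Section Coroots.
Variables (R : realType) (n : nat) (phi : root_system R n).
Local Notation V := 'rV[R]_n.
Implicit Types (u v : V) (a b : V) (f g : 'cV[R]_n).

(** Summing over all roots makes this form on V^* invariant under the reflections, and it is
    positive definite because the roots span V. *)
Let coform f g := \sum_(b <- roots phi) pairing b f * pairing b g.

Lemma roots_separate f : (forall b, b \in roots phi -> pairing b f = 0) -> f = 0.
Proof.
move=> h; apply: pairing_injr => v.
have: (<<enum_fset (roots phi)>> <= lker (linfun (mulmxr f)))%VS.
  apply/span_subvP => b hb; rewrite memv_ker lfunE /=.
  by apply/eqP/matrixP => i j; rewrite !ord1 [RHS]mxE; exact: h.
rewrite roots_span => /subvP/(_ v (memvf _)).
by rewrite memv_ker lfunE /= /pairing => /eqP ->; rewrite mxE.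
Qed.

(** The reflection [s] permutes the roots, so reindexing the sum by [s] does not change it, while
    [s] negates the pairing with [coroot phi a]. *)
Lemma coform_coroot a f : a \in roots phi ->
  2 * coform f (coroot phi a) =
  pairing a f * coform (coroot phi a) (coroot phi a).
Proof.
move=> ha; pose s b := b - pairing b (coroot phi a) *: a.
have sK : involutive s.
  move=> b; rewrite /s pairingBl pairingZl pairing_coroot //.
  by rewrite (_ : _ - _ = - pairing b (coroot phi a)) ?scaleNr ?opprK ?subrK //; ring.
have : coform f (coroot phi a) =
    \sum_(b <- roots phi) pairing (s b) f * pairing (s b) (coroot phi a).
  rewrite /coform -(big_map s xpredT
    (fun b => pairing b f * pairing b (coroot phi a))).
  apply: perm_big; apply: uniq_perm; first exact: fset_uniq.
    by rewrite (map_inj_uniq (inv_inj sK)) fset_uniq.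
  move=> b; apply/idP/mapP => [hb|[c hc ->]]; last exact: roots_reflection.
  by exists (s b); [exact: roots_reflection|rewrite sK].
have -> : \sum_(b <- roots phi) pairing (s b) f * pairing (s b) (coroot phi a) =
    pairing a f * coform (coroot phi a) (coroot phi a) - coform f (coroot phi a).
  rewrite /coform mulr_sumr -sumrB; apply: eq_bigr => b _.
  by rewrite /s !pairingBl !pairingZl pairing_coroot //; ring.
lra.
Qed.

(** The classical formula for a coroot as a multiple of its root: by [coform_coroot] the Gram matrix
    [G] of [coform] sends the coroot to a positive multiple of the root, and [J] is its inverse. *)
Lemma coroot_dual : exists2 J : 'M[R]_n, J \in unitmx &
  forall a, a \in roots phi -> exists2 N, 0 < N & coroot phi a = N *: (J *m a^T).
Proof.
pose G : 'M[R]_n := \sum_(b <- roots phi) b^T *m b.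
have GE f g : (f^T *m G *m g) 0 0 = coform f g.
  rewrite /G mulmx_sumr mulmx_suml summxE; apply: eq_bigr => b _.
  have -> : f^T *m (b^T *m b) *m g = (b *m f)^T *m (b *m g).
    by rewrite trmx_mul !mulmxA.
  by rewrite mxE big_ord1 mxE.
have coform0 f : coform f f = 0 -> f = 0.
  move=> h; apply: roots_separate => b hb.
  have/eqP := h; rewrite /coform psumr_eq0; last first.
    by move=> c _; rewrite -expr2 sqr_ge0.
  by move=> /allP/(_ _ hb)/=; rewrite mulf_eq0 orbb => /eqP.
have Gtr : G^T = G.
  by rewrite /G linear_sum; apply: eq_bigr => b _; rewrite /= trmx_mul trmxK.
have uG : G \in unitmx.
  rewrite -row_free_unit; apply: inj_row_free => v vG0.
  apply/eqP; rewrite -trmx_eq0; apply/eqP/coform0.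
  by rewrite -GE trmxK vG0 mul0mx mxE.
exists (invmx G); first by rewrite unitmx_inv.
move=> a ha; set c := coroot phi a.
have c0 : 0 < coform c c.
  rewrite lt_neqAle eq_sym sumr_ge0 ?andbT; last first.
    by move=> b _; rewrite -expr2 sqr_ge0.
  apply/eqP => /coform0 c0; have := pairing_coroot ha.
  by rewrite -/c c0 /pairing mulmx0 mxE => /eqP; rewrite eq_sym pnatr_eq0.
have Gc : G *m c = (coform c c / 2) *: a^T.
  apply/eqP; rewrite -subr_eq0 -trmx_eq0; apply/eqP/pairing_inj => f.
  have -> : (G *m c - coform c c / 2 *: a^T)^T = c^T *m G - (coform c c / 2) *: a.
    by rewrite linearB linearZ /= trmxK trmx_mul Gtr.
  rewrite pairingBl pairingZl {1}/pairing GE /coform.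
  under eq_bigr do rewrite mulrC.
  have := coform_coroot f ha; rewrite -/c /coform => h; lra.
exists (coform c c / 2); first by rewrite divr_gt0.
by rewrite scalemxAr -Gc mulmxA mulVmx // mul1mx.
Qed.

Lemma coroots_separate v :
  (forall a, a \in roots phi -> pairing v (coroot phi a) = 0) -> v = 0.
Proof.
case: coroot_dual => J uJ hJ h.
suff vJ : v *m J = 0 by rewrite -[v](mulmxK uJ) vJ mul0mx.
apply: trmx_inj; rewrite trmx0; apply: roots_separate => a ha.
have [N N0 E] := hJ a ha; have := h a ha.
rewrite E pairingZr => /eqP; rewrite mulf_eq0 gt_eqF //= => /eqP h0.
by rewrite -[RHS]h0 /pairing mulmxA -[a in LHS]trmxK -trmx_mul mxE.
Qed.

(* By [coroot_dual] the sign of a vector v on a coroot is the sign of a dual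
   vector u on the root; take u equal to -1 on all simple roots. *)
Lemma antidominant_regular (alpha : n.-tuple V) : root_basis phi alpha ->
  exists2 v, linear_regular phi v &
    forall i, pairing v (coroot phi (tnth alpha i)) < 0.
Proof.
case=> bas inR sgn; case: coroot_dual => J uJ hJ.
pose g v := \sum_j coord alpha j v.
pose u : 'cV[R]_n := \col_k - g (delta_mx 0 k).
have gE v : g v = \sum_k v 0 k * g (delta_mx 0 k).
  rewrite [in LHS](row_sum_delta v) /g.
  under eq_bigr do rewrite linear_sum /=.
  rewrite exchange_big /=; apply: eq_bigr => k _.
  by rewrite mulr_sumr; apply: eq_bigr => j _; rewrite linearZ.
have uE i : pairing (tnth alpha i) u = -1.
  have -> : pairing (tnth alpha i) u = - g (tnth alpha i).
    by rewrite /pairing mxE gE -sumrN; apply: eq_bigr => k _; rewrite mxE mulrN.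
  congr (- _).
  rewrite /g (bigD1 i) //= (tnth_nth 0) coord_free ?(basis_free bas) // eqxx.
  rewrite big1 ?addr0 // => j ji; rewrite coord_free ?(basis_free bas) //.
  by rewrite eq_sym (negbTE ji).
have prE a : a \in roots phi ->
    exists2 N, 0 < N & pairing (u^T *m invmx J) (coroot phi a) = N * pairing a u.
  move=> ha; have [N N0 ->] := hJ a ha; exists N => //.
  rewrite pairingZr; congr (_ * _); rewrite /pairing !mulmxA mulmxKV //.
  by rewrite -trmx_mul mxE.
exists (u^T *m invmx J) => [a ha|i]; last first.
  by have [N N0 ->] := prE _ (inR i); rewrite uE mulrN1 oppr_lt0.
have [N N0] := prE _ ha; rewrite /hyperplane /= => -> /eqP.
rewrite mulf_eq0 gt_eqF //=.
have pm m : pairing (\sum_i tnth alpha i *+ m i) u = - (\sum_i m i)%:R.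
  rewrite pairing_sum natr_sum -sumrN; apply: eq_bigr => i _.
  by rewrite -scaler_nat pairingZl uE mulrN1.
(* The coefficients of a root all have one sign, so their sum vanishes only if each of them does,
   which would make the root zero. *)
have [m E] := sgn a ha.
have m0 : pairing a u == 0 -> (\sum_i m i == 0)%N.
  by case: E => ->; rewrite ?pairingNl pm ?oppr_eq0 pnatr_eq0.
move=> /m0; rewrite sum_nat_eq0 => /forallP m00.
move: (roots_neq0 phi).
have -> : 0 = a; last by rewrite ha.
by case: E => ->; rewrite big1 ?oppr0 // => i _; rewrite (eqP (implyP (m00 i) isT)).
Qed.

End Coroots.
(** * Simplicial complexes and galleries *)

Section GalleryPaths.
Variables (P Q : Type).
Implicit Types (K : set (set P)) (c s d : set P) (l : seq (set P * set P)).

Lemma panel_sub c s : panel_of c s -> s `<=` c.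
Proof. by move=> [p _ ->] q []. Qed.

(** For E this property comes from the building, by [panels_shared_complex]; the results on
    distances in E take it as a hypothesis. *)
Definition panels_shared K := forall c s, chamber K c -> panel_of c s ->
  exists d, [/\ chamber K d, panel_of d s & d <> c].

Fixpoint all_steps (S : set P -> set P -> set P -> Prop) c l : Prop :=
  if l is x :: l' then S c x.1 x.2 /\ all_steps S x.2 l' else True.

Lemma all_stepsP S c l : all_steps S c l <-> forall i, (i < size l)%N ->
  S (nth set0 (c :: unzip2 l) i) (nth set0 (unzip1 l) i)
    (nth set0 (c :: unzip2 l) i.+1).
Proof.
elim: l c => [|x l IH] c //=; split=> [[Sx /IH h] [|i]//|h].
  by rewrite ltnS => /h.
by split; [exact: (h 0%N)|apply/IH => i il; exact: (h i.+1)].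
Qed.

Definition nonstuttering := all_steps (fun c _ d => d <> c).

(** Recursive form of [is_gallery] without source and target, suited to concatenation and to
    induction on the steps. That [c] is a chamber is stated separately. *)
Fixpoint gallery_path K c l : Prop :=
  if l is x :: l' then
    [/\ chamber K x.2, panel_of c x.1, panel_of x.2 x.1 & gallery_path K x.2 l']
  else True.

Definition gallery_end c l : set P := last c (unzip2 l).

Lemma gallery_path_cat K c l1 l2 : gallery_path K c (l1 ++ l2) <->
  gallery_path K c l1 /\ gallery_path K (gallery_end c l1) l2.
Proof.
elim: l1 c => [|x l1 IH] c; first by split=> [|[]].
rewrite /= {}/gallery_end /=; split.
  by move=> [h1 h2 h3 /IH[h4 h5]].
by move=> [[h1 h2 h3 h4] h5]; split=> //; apply/IH.
Qed.

Lemma gallery_end_cat c l1 l2 :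
  gallery_end c (l1 ++ l2) = gallery_end (gallery_end c l1) l2.
Proof. by rewrite /gallery_end /unzip2 map_cat last_cat. Qed.

Lemma gallery_end_chamber K c l :
  chamber K c -> gallery_path K c l -> chamber K (gallery_end c l).
Proof. by elim: l c => //= x l IH c _ [dx _ _]; exact: IH. Qed.

Lemma gallery_path_steps K c l : gallery_path K c l <->
  all_steps (fun c s d => [/\ chamber K d, panel_of c s & panel_of d s]) c l.
Proof.
by elim: l c => [|x l IH] c //=; split=> [[h1 h2 h3 /IH]|[[h1 h2 h3] /IH]].
Qed.

Lemma is_galleryP K (g : gallery P) : is_gallery K g <->
  [/\ chamber K (ghead g), ghead g (gsource g),
      gallery_end (ghead g) (gsteps g) (gtarget g)
    & gallery_path K (ghead g) (gsteps g)].
Proof.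
have endE : galcove g (glength g) = gallery_end (ghead g) (gsteps g).
  rewrite /galcove /glength /gallery_end -[size _](size_map snd).
  by rewrite -[X in nth _ _ X]/((size (ghead g :: unzip2 (gsteps g))).-1) nth_last.
split=> [[hc h0 he hp]|[h0 hs he /gallery_path_steps/all_stepsP hp]].
  rewrite -endE; split=> //; first exact: (hc 0%N).
  apply/gallery_path_steps/all_stepsP => i il.
  by have [p1 p2] := hp i il; split=> //; exact: hc.
split=> //; last by move=> i /hp[].
  by case=> [|i il] //; have [] := hp i il.
by rewrite endE.
Qed.

(** Minimality as a property of the two ends and a number only, so that it can be passed between X
    and E without a particular gallery. *)
Definition minimal_length K (p q : P) m := forall c l, chamber K c ->
  gallery_path K c l -> c p -> gallery_end c l q -> (m <= size l)%N.

Lemma minimal_galleryP K (g : gallery P) : minimal_gallery K g <->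
  is_gallery K g /\ minimal_length K (gsource g) (gtarget g) (size (gsteps g)).
Proof.
split=> -[gg gmin]; split=> //.
  move=> c l cc lp cs ct; apply: (gmin (Gallery (gsource g) c l (gtarget g))) => //.
  exact/is_galleryP.
move=> g' /is_galleryP[h1 h2 h3 h4] sE tE.
by apply: gmin h1 h4 _ _; rewrite -?sE -?tE.
Qed.

Definition map_path (f : P -> Q) l := [seq (f @` x.1, f @` x.2) | x <- l].

End GalleryPaths.

Lemma map_path_end (P Q : Type) (f : P -> Q) (c : set P) (l : seq (set P * set P)) :
  gallery_end (f @` c) (map_path f l) = f @` gallery_end c l.
Proof. by elim: l c => //= x l IH c; exact: IH. Qed.

Lemma size_map_path (P Q : Type) (f : P -> Q) (l : seq (set P * set P)) :
  size (map_path f l) = size l.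
Proof. exact: size_map. Qed.

(** * The Coxeter complex *)

Section Arrangement.
Variables (R : realType) (n : nat) (phi : root_system R n).
Local Notation V := 'rV[R]_n.
Implicit Types (a b u v w p x y : V) (k : int) (f : 'cV[R]_n) (H : set V).
Local Notation "''<' v , a >" := (pairing v (coroot phi a))
  (at level 0, v at level 9, a at level 9, format "''<' v ,  a >").
Local Notation regular := (affine_regular phi).
Local Notation E := (coxeter_complex phi).

(** For regular [v] this is the alcove of [v], by [alcove_cell]: the topological definition becomes
    finitely many inequalities. *)
Definition cell v : set V :=
  [set u | forall a, a \in roots phi ->
     (Num.floor '<v, a>)%:~R <= '<u, a> <= (Num.floor '<v, a> + 1)%:~R].

Definition cell_vertices v : set V := cell v `&` is_vertex phi.

Lemma regular_floor v a : affine_regular phi v -> a \in roots phi ->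
  (Num.floor '<v, a>)%:~R < '<v, a>.
Proof.
move=> rv ra; rewrite lt_neqAle floor_le andbT; apply/eqP => E.
by apply: (rv a (Num.floor '<v, a>) ra); rewrite /hyperplane /= E.
Qed.

Lemma regularP v :
  (forall a, a \in roots phi -> '<v, a> \isn't a Num.int) <-> affine_regular phi v.
Proof.
split=> [h a k ra E|rv a ra].
  by have := h a ra; rewrite E intr_int.
by apply/negP => /intrP[k E]; apply: (rv a k ra).
Qed.

(** In one direction, no coroot passes an integer on the component. In the other, the half-open
    segment from [v] to a point of the cell satisfies the strict inequalities. *)
Lemma alcove_cell v : affine_regular phi v ->
  closure (connected_component (affine_regular phi) v) = cell v.
Proof.
move=> rv; apply/seteqP; split=> u.
  move=> cu a ra; apply/andP; split.
    apply: (component_ge rv _ _ cu); first exact: regular_floor.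
    by move=> w rw; apply/eqP => E; apply: (rw a _ ra); exact: E.
  apply: (component_le rv _ _ cu); first exact: floorD1_gt.
  by move=> w rw; apply/eqP => E; apply: (rw a _ ra); exact: E.
move=> cu; apply: segment_closure => t /andP[t0 t1].
apply/regularP => a ra; rewrite pairing_segment.
have /andP[u1 u2] := cu a ra.
have v1 := regular_floor rv ra; have v2 := floorD1_gt '<v, a>.
set k := Num.floor _ in u1 u2 v1 v2.
rewrite intrEfloor (@floor_def _ _ k).
  by apply/eqP => E; rewrite intrD in u2 v2; nra.
by rewrite intrD in u2 v2 *; apply/andP; split; nra.
Qed.

Lemma cell_refl v : cell v v.
Proof. by move=> a _; rewrite floor_le ltW // floorD1_gt. Qed.

Lemma cell_floor v w a : affine_regular phi w -> cell v w -> a \in roots phi ->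
  Num.floor '<w, a> = Num.floor '<v, a>.
Proof.
move=> rw cw ra; have /andP[h1 h2] := cw a ra.
apply: floor_def; rewrite h1 /= lt_neqAle h2 andbT; apply/eqP => E.
exact: (rw a _ ra E).
Qed.

Lemma cell_eq v w : affine_regular phi w -> cell v w -> cell w = cell v.
Proof.
move=> rw cw; apply/seteqP; split => u cu a ra; have := cu a ra;
by rewrite (cell_floor rw cw ra).
Qed.

Lemma cell_side v u a k : cell v u -> a \in roots phi ->
  0 <= ('<v, a> - k%:~R) * ('<u, a> - k%:~R).
Proof.
move=> cu ra; have /andP[h1 h2] := cu a ra.
have [kv|vk] := leP k%:~R '<v, a>.
  rewrite mulr_ge0 ?subr_ge0 // (le_trans _ h1) // ler_int floor_ge_int //.
rewrite nmulr_rge0 ?subr_lt0 // subr_le0 (le_trans h2) // ler_int.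
by rewrite -floor_lt_int in vk; rewrite lezD1.
Qed.

Lemma not_cell v w : affine_regular phi v -> affine_regular phi w -> ~ cell v w ->
  exists a k, a \in roots phi /\ ('<v, a> - k%:~R) * ('<w, a> - k%:~R) < 0.
Proof.
move=> rv rw /existsNP[a /not_implyP[ra /negP h]].
have := h; rewrite negb_and -!ltNge => /orP[h1|h1].
  exists a, (Num.floor '<v, a>); split=> //.
  by rewrite nmulr_llt0 ?subr_lt0 // subr_gt0 regular_floor.
exists a, (Num.floor '<v, a> + 1); split=> //.
by rewrite nmulr_rlt0 ?subr_lt0 ?subr_gt0 // floorD1_gt.
Qed.

Lemma cell_perturb v w : affine_regular phi v ->
  exists2 t, 0 < t & cell v (v + t *: w).
Proof.
move=> rv.
have : \forall t \near (0 : R)^'+, forall a, a \in enum_fset (roots phi) ->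
  (Num.floor '<v, a>)%:~R <= '<(v + t *: w), a> <= (Num.floor '<v, a> + 1)%:~R.
  apply: near_right_all => a ra.
  have v1 := regular_floor rv ra; have v2 := floorD1_gt '<v, a>.
  near=> t; rewrite pairingDl pairingZl; apply/andP; split.
    rewrite -subr_ge0 addrAC ltW //; near: t.
    by apply: near_right_affine; rewrite subr_gt0.
  rewrite -subr_ge0 opprD addrA -mulrN ltW //; near: t.
  by apply: near_right_affine; rewrite subr_gt0.
move=> near_cell.
have : \forall t \near (0 : R)^'+, 0 < t /\ cell v (v + t *: w).
  by apply: filterS2 near_cell (nbhs_right_gt 0) => t ct t0.
by move=> /filter_ex [t [t0 ct]]; exists t.
Unshelve. all: by end_near. Qed.

Lemma cell_affine0 v f (k : R) : affine_regular phi v ->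
  (forall u, cell v u -> pairing u f = k) -> forall u, pairing u f = k.
Proof.
move=> rv h.
have f0 : forall u, pairing u f = 0.
  move=> u; have [t t0 ct] := cell_perturb u rv.
  have := h _ ct; rewrite pairingDl pairingZl (h v (@cell_refl v)) => /eqP.
  by rewrite -subr_eq0 addrC addKr mulf_eq0 gt_eqF //= => /eqP.
by move=> u; rewrite -(h v (@cell_refl v)) !f0.
Qed.

(* Moving from u along a line contained in all walls through u, one meets a
   further wall before leaving the alcove. *)
Lemma cell_exit v u w : cell v u -> w != 0 ->
  (forall a, a \in roots phi -> '<u, a> \is a Num.int -> '<w, a> = 0) ->
  exists t, [/\ 0 < t, cell v (u + t *: w) & exists a, [/\ a \in roots phi,
    '<u, a> \isn't a Num.int & '<(u + t *: w), a> \is a Num.int]].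
Proof.
move=> cu w0 hw.
pose fl a : R := (Num.floor '<v, a>)%:~R.
(* [e a] is the time at which the ray from [u] in direction [w] reaches the bounding hyperplane of
   [a] that lies ahead; the root with the least time gives the exit. *)
pose e a := if 0 < '<w, a> then (fl a + 1 - '<u, a>) / '<w, a>
            else (fl a - '<u, a>) / '<w, a>.
pose s := [seq a <- enum_fset (roots phi) | '<w, a> != 0].
have [b bs] : exists b, b \in s.
  apply: contrapT => /forallNP ns; move/eqP: w0; apply.
  apply: coroots_separate => a ra; apply: contrapT => /eqP wa.
  by apply: (ns a); rewrite mem_filter wa; exact: ra.
have [a as_ amin] := seq_argmin e bs.
move: as_; rewrite mem_filter => /andP[wa ra].
have strict c : c \in roots phi -> '<w, c> != 0 -> fl c < '<u, c> < fl c + 1.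
  move=> rc wc; have nint : '<u, c> \isn't a Num.int.
    by apply/negP => /(hw c rc) /eqP; rewrite (negbTE wc).
  have := cu c rc; rewrite -/(fl c) intrD => /andP[h1 h2].
  rewrite !lt_neqAle h1 h2 !andbT; apply/andP; split; apply: contraNneq nint.
    by move=> <-; exact: intr_int.
  by move=> ->; rewrite -[1]/(1%:~R) -intrD intr_int.
have eP c : c \in roots phi -> '<w, c> != 0 -> 0 < e c.
  move=> rc wc; have /andP[h1 h2] := strict c rc wc; rewrite /e; case: ifPn => w1.
    by rewrite divr_gt0 // subr_gt0.
  by rewrite nmulr_rgt0 ?subr_lt0 // invr_lt0 lt_neqAle wc leNgt.
exists (e a); split; first exact: eP.
- move=> c rc; have := cu c rc; rewrite -/(fl c) intrD -[1%:~R]/(1 : R).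
  rewrite pairingDl pairingZl => /andP[h1 h2].
  have ea := eP a ra wa.
  have [wc|wc|wc] := ltgtP '<w, c> 0; last by rewrite wc mulr0 addr0 h1.
  + have : e a <= e c by apply: amin; rewrite mem_filter lt_eqF //; exact: rc.
    rewrite [e c]/e ltNge (ltW wc) /= ler_ndivlMr // => h3.
    by apply/andP; split; nra.
  + have : e a <= e c by apply: amin; rewrite mem_filter gt_eqF //; exact: rc.
    rewrite [e c]/e wc ler_pdivlMr // => h3.
    by apply/andP; split; nra.
exists a; split=> //; first by apply/negP => /(hw a ra) /eqP; rewrite (negbTE wa).
rewrite pairingDl pairingZl /e; case: ifP => _; rewrite divfK // addrC subrK.
  by rewrite -[1]/(1%:~R) -intrD intr_int.
exact: intr_int.
Qed.

(* An alcove is the convex hull of its vertices: by induction on the number of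
   walls through u, which increases at the two ends of a segment through u. *)
Lemma cell_vertices_constant v f (k : R) :
  (forall p, cell_vertices v p -> pairing p f = k) ->
  forall u, cell v u -> pairing u f = k.
Proof.
move=> h u; pose nint u a := '<u, a> \isn't a Num.int.
have [m] := ubnP (count (nint u) (enum_fset (roots phi))).
elim: m u => // m IH u; rewrite ltnS => um cu.
have [uv|/existsNP[q /not_implyP[hq qu]]] := pselect (is_vertex phi u); first exact: h.
have w0 : q - u != 0 by rewrite subr_eq0; apply/eqP.
have hw a : a \in roots phi -> '<u, a> \is a Num.int -> '<(q - u), a> = 0.
  move=> ra /intrP[l E]; rewrite pairingBl E.
  by rewrite (hq a l ra E) subrr.
have IHw w : w != 0 ->
    (forall a, a \in roots phi -> '<u, a> \is a Num.int -> '<w, a> = 0) ->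
    exists2 t, 0 < t & pairing u f + t * pairing w f = k.
  move=> wn hu; have [t [t0 ct [a [ra ua ta]]]] := cell_exit cu wn hu.
  exists t => //; rewrite -pairingZl -pairingDl; apply: IH ct.
  apply: leq_trans um; apply: (count_sub (i := a)) => //.
    move=> b rb; apply: contraNN => ub.
    by rewrite pairingDl pairingZl (hu b) // mulr0 addr0.
  by rewrite /nint ta.
have [t t0 E] := IHw _ w0 hw.
have [||t' t'0 E'] := IHw (- (q - u)).
- by rewrite oppr_eq0.
- by move=> a ra ua; rewrite pairingNl hw // oppr0.
move: E'; rewrite pairingNl mulrN => E'.
have : (t + t') * pairing (q - u) f = 0 by lra.
by move=> /eqP; rewrite mulf_eq0 gt_eqF ?addr_gt0 //= => /eqP q0; rewrite -E q0; ring.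
Qed.

(** The vertices of an alcove affinely span V, the alcove being a neighbourhood of [v]. In
    particular no wall contains them all. *)
Lemma cell_vertices_affine v f (k : R) : regular v ->
  (forall p, cell_vertices v p -> pairing p f = k) ->
  forall u, pairing u f = k.
Proof. by move=> rv /cell_vertices_constant/(cell_affine0 rv). Qed.

(** A vertex is determined by the hyperplanes through it, and inside the cell each root allows only
    its two bounding ones; [F] records which of them occur. *)
Lemma cell_vertices_finite v : finite_set (cell_vertices v).
Proof.
pose F p : {ffun roots phi -> bool * bool} :=
  [ffun a => ('<p, (val a)> == (Num.floor '<v, (val a)>)%:~R,
              '<p, (val a)> == (Num.floor '<v, (val a)> + 1)%:~R)].
pose G t := xget 0 [set p | cell_vertices v p /\ F p = t].
apply: (@sub_finite_set _ _ (G @` setT)); last first.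
  by apply: finite_image; exact: finite_finset.
move=> p vp; exists (F p) => //; rewrite /G.
case: xgetP => [q _ [vq Fq]|/(_ p)]; last by case.
case: vp vq => cp vp [cq _]; apply: vp => a k ra pk.
have := congr1 (fun g : {ffun roots phi -> bool * bool} => g (FSetSub ra)) Fq.
rewrite !ffunE /= pk => -[E1 E2].
have /andP[h1 h2] := cp a ra; rewrite pk !ler_int in h1 h2.
rewrite !eqr_int in E1 E2.
have [kf|kf] := eqVneq k (Num.floor '<v, a>).
  by move: E1; rewrite kf eqxx => /eqP.
have kf1 : k = Num.floor '<v, a> + 1.
  by apply/eqP; rewrite eq_le h2 /= lezD1 lt_neqAle eq_sym kf h1.
by move: E2; rewrite kf1 eqxx => /eqP.
Qed.

Lemma complexP s :
  coxeter_complex phi s <-> exists2 v, regular v & s `<=` cell_vertices v.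
Proof.
split=> [[c [v rv ->]]|[v rv sv]]; first by rewrite alcove_cell //; exists v.
by exists (cell v) => //; exists v => //; rewrite alcove_cell.
Qed.

(** If a wall separated [v] from [w], the vertices of the first alcove would lie weakly on both
    sides of it, hence all on it. *)
Lemma cell_vertices_sub v w : regular v -> regular w ->
  cell_vertices v `<=` cell w -> cell w v.
Proof.
move=> rv rw vw; apply: contrapT => nvw.
have [a [k [ra sep]]] := not_cell rw rv nvw.
suff : '<v, a> = k%:~R by move=> E; exact: (rv a k ra).
apply: (cell_vertices_affine rv) => p vp.
have := cell_side k (vw p vp) ra; have := cell_side k vp.1 ra.
by move=> h1 h2; apply/eqP; rewrite -subr_eq0; apply/eqP; exact: (between_eq0 sep).
Qed.

Lemma chamberP c :
  chamber (coxeter_complex phi) c <-> exists2 v, regular v & c = cell_vertices v.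
Proof.
split=> [[/complexP[v rv cv] cmax]|[v rv ->]].
  by exists v => //; apply/esym/cmax => //; apply/complexP; exists v.
split=> [|s /complexP[w rw sw] vs]; first by apply/complexP; exists v.
have cwv : cell w v by apply: cell_vertices_sub => // p /vs /sw [].
apply/seteqP; split=> //; apply: (subset_trans sw).
by rewrite /cell_vertices (cell_eq rv cwv).
Qed.

Lemma cell_vertices_eq v w : regular v -> regular w ->
  cell_vertices v = cell_vertices w <-> cell v w.
Proof.
move=> rv rw; split=> [h|h].
  by apply: cell_vertices_sub => //; rewrite -h => p [].
by rewrite /cell_vertices (cell_eq rw h).
Qed.

Lemma regular_neq0 v a k : regular v -> a \in roots phi -> '<v, a> - k%:~R != 0.
Proof. by move=> rv ra; rewrite subr_eq0; apply/eqP => E; exact: (rv a k ra). Qed.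

(** Stated for the set [H], with no choice of root and integer, so that a wall given by several
    roots is counted once. *)
Definition crosses v w H := exists2 t : R, 0 < t < 1 & H (v + t *: (w - v)).

Lemma crossesP v w a k : regular v -> regular w -> a \in roots phi ->
  crosses v w (hyperplane phi a k) <->
  ('<v, a> - k%:~R) * ('<w, a> - k%:~R) < 0.
Proof.
move=> rv rw ra.
have v0 := regular_neq0 k rv ra; have w0 := regular_neq0 k rw ra.
split=> [[t /andP[t0 t1]]|h].
  rewrite /hyperplane /= pairing_segment => E.
  have {}E : (1 - t) * ('<v, a> - k%:~R) = - (t * ('<w, a> - k%:~R)).
    have -> : (1 - t) * ('<v, a> - k%:~R) = (1 - t) * '<v, a> + t * '<w, a>
      - k%:~R - t * ('<w, a> - k%:~R) by ring.
    by rewrite E; ring.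
  move: E v0 w0; set x := _ - _; set y := _ - _ => E v0 w0.
  rewrite -(@pmulr_rlt0 _ (1 - t)) ?subr_gt0 // mulrA E mulNr oppr_lt0 -mulrA.
  by rewrite pmulr_rgt0 // -expr2 exprn_even_gt0.
move: h; set x := '<v, a> - _; set y := '<w, a> - _ => h.
have xy : x - y != 0.
  by apply/eqP => xy; move: h; rewrite (_ : x * y = y ^+ 2) ?ltNge ?sqr_ge0 //; nra.
exists (x / (x - y)).
  have [x0|x0] : 0 < x \/ x < 0 by move: v0; rewrite -/x neq_lt => /orP; tauto.
    have y0 : y < 0 by nra.
    have d0 : 0 < x - y by lra.
    by apply/andP; split; [exact: divr_gt0|rewrite ltr_pdivrMr //; lra].
  have -> : x / (x - y) = (- x) / (y - x) by rewrite -(opprB x y) invrN mulrNN.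
  have y0 : 0 < y by nra.
  have d0 : 0 < y - x by lra.
  by apply/andP; split; [apply: divr_gt0; lra|rewrite ltr_pdivrMr //; lra].
rewrite /hyperplane /= pairing_segment.
have -> : '<v, a> = x + k%:~R by rewrite subrK.
have -> : '<w, a> = y + k%:~R by rewrite subrK.
by field.
Qed.

Lemma crosses_either u v w H : regular u -> regular v -> regular w ->
  is_wall phi H -> crosses v w H -> crosses v u H \/ crosses u w H.
Proof.
move=> ru rv rw [a [k [ra ->]]] /crossesP -/(_ rv rw ra) h.
have := regular_neq0 k ru ra; rewrite neq_lt => /orP u0.
have : ('<v, a> - k%:~R) * ('<u, a> - k%:~R) < 0 \/
       ('<u, a> - k%:~R) * ('<w, a> - k%:~R) < 0.
  move: h u0; set x := _ - _; set y := _ - _; set z := _ - _ => h u0.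
  have [x0|x0] : 0 < x \/ x < 0.
  - by apply/orP; rewrite orbC -neq_lt; apply/eqP => x0; rewrite x0 mul0r ltxx in h.
  - by case: u0; [left|right]; nra.
  - by case: u0; [right|left]; nra.
by case=> h'; [left|right]; apply/crossesP.
Qed.

Lemma crossesC v w H : regular v -> regular w -> is_wall phi H ->
  crosses v w H -> crosses w v H.
Proof.
move=> rv rw [a [k [ra ->]]] /crossesP -/(_ rv rw ra) h.
by apply/crossesP => //; rewrite mulrC.
Qed.

Lemma cell_not_crosses v w H : regular v -> regular w -> is_wall phi H ->
  cell v w -> ~ crosses v w H.
Proof.
move=> rv rw [a [k [ra ->]]] vw /crossesP -/(_ rv rw ra).
by rewrite ltNge cell_side.
Qed.

Lemma cell_crosses v w : regular v -> regular w -> ~ cell v w ->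
  exists2 H, is_wall phi H & crosses v w H.
Proof.
move=> rv rw /(not_cell rv rw) [a [k [ra h]]].
by exists (hyperplane phi a k); [exists a, k|apply/crossesP].
Qed.

Lemma crosses3 u v w H : regular u -> regular v -> regular w -> is_wall phi H ->
  crosses u v H -> crosses v w H -> ~ crosses u w H.
Proof.
move=> ru rv rw [a [k [ra ->]]].
move=> /crossesP -/(_ ru rv ra) h1 /crossesP -/(_ rv rw ra) h2.
move=> /crossesP -/(_ ru rw ra) h3.
move: h1 h2 h3; set x := _ - _; set y := _ - _; set z := _ - _ => h1 h2 h3.
have : 0 < (x * y) * (y * z) by rewrite nmulr_lgt0.
have -> : (x * y) * (y * z) = y ^+ 2 * (x * z) by ring.
by rewrite nmulr_lgt0 // ltNge sqr_ge0.
Qed.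

Lemma crosses_panel v w s H : regular v -> regular w -> is_wall phi H ->
  crosses v w H -> s `<=` cell_vertices v -> s `<=` cell_vertices w -> s `<=` H.
Proof.
move=> rv rw [a [k [ra ->]]] /crossesP -/(_ rv rw ra) h sv sw p sp.
rewrite /hyperplane /=; apply/eqP; rewrite -subr_eq0; apply/eqP.
apply: (between_eq0 h); apply: cell_side => //; [exact: (sv _ sp).1|exact: (sw _ sp).1].
Qed.

(* The panel spans a hyperplane, as the vertices of the alcove span V. *)
Lemma panel_wall_unique v s H H' : regular v -> panel_of (cell_vertices v) s ->
  is_wall phi H -> is_wall phi H' -> s `<=` H -> s `<=` H' -> H = H'.
Proof.
move=> rv [p vp ->] [a [k [ra ->]]] [b [l [rb ->]]] sa sb.
have apex (r : V) m : r \in roots phi ->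
    cell_vertices v `\ p `<=` hyperplane phi r m -> '<p, r> - m%:~R != 0.
  move=> rc sc; apply/eqP => pc; apply: (rv r m rc).
  apply: (cell_vertices_affine rv) => q vq.
  have [->|qp] := pselect (q = p); first by apply/eqP; rewrite -subr_eq0 pc.
  exact: (sc q).
have A0 := apex _ _ ra sa; have B0 := apex _ _ rb sb.
set A := '<p, a> - k%:~R in A0; set B := '<p, b> - l%:~R in B0.
(* Both sides are affine in [u], vanish on the panel and equal [A * B] at the remaining vertex
   [p]. *)
have prop u : B * ('<u, a> - k%:~R) = A * ('<u, b> - l%:~R).
  have : pairing u (B *: coroot phi a - A *: coroot phi b) = B * k%:~R - A * l%:~R.
    apply: (cell_vertices_affine rv) => q vq.
    rewrite pairingDr pairingNr !pairingZr.
    have [->|qp] := pselect (q = p); first by rewrite /A /B; ring.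
    have -> : '<q, a> = k%:~R by apply: sa.
    by have -> : '<q, b> = l%:~R by apply: sb.
  by rewrite pairingDr pairingNr !pairingZr => h; rewrite !mulrBr; lra.
apply/seteqP; rewrite /hyperplane; split=> u /= E; have := prop u; rewrite E subrr mulr0.
  by move/esym/eqP; rewrite mulf_eq0 (negbTE A0) /= subr_eq0 => /eqP.
by move/eqP; rewrite mulf_eq0 (negbTE B0) /= subr_eq0 => /eqP.
Qed.

Lemma panel_crosses_unique v w s H H' : regular v -> regular w ->
  panel_of (cell_vertices v) s -> panel_of (cell_vertices w) s ->
  is_wall phi H -> is_wall phi H' -> crosses v w H -> crosses v w H' -> H = H'.
Proof.
move=> rv rw pv pw wH wH' sH sH'.
apply: (panel_wall_unique rv pv) => //.
  exact: (crosses_panel rv rw) (panel_sub pv) (panel_sub pw).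
exact: (crosses_panel rv rw) (panel_sub pv) (panel_sub pw).
Qed.

(** If the three alcoves were distinct, the walls separating the three pairs would all contain [s],
    hence coincide; but one wall cannot separate each pair among three points. *)
Lemma thin c d e s : chamber E c -> chamber E d -> chamber E e ->
  panel_of c s -> panel_of d s -> panel_of e s -> d <> c -> e <> c -> d = e.
Proof.
move=> /chamberP[v rv ->] /chamberP[w rw ->] /chamberP[z rz ->] pv pw pz.
move=> /nesym /cell_vertices_eq -/(_ rv rw) nvw.
move=> /nesym /cell_vertices_eq -/(_ rv rz) nvz.
apply/cell_vertices_eq => //; apply: contrapT => nwz.
have [H1 w1 s1] := cell_crosses rv rw nvw.
have [H2 w2 s2] := cell_crosses rv rz nvz.
have [H3 w3 s3] := cell_crosses rw rz nwz.
have sub1 := crosses_panel rv rw w1 s1 (panel_sub pv) (panel_sub pw).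
have sub2 := crosses_panel rv rz w2 s2 (panel_sub pv) (panel_sub pz).
have sub3 := crosses_panel rw rz w3 s3 (panel_sub pw) (panel_sub pz).
move: s2 s3; rewrite -(panel_wall_unique rv pv w1 w2 sub1 sub2).
rewrite -(panel_wall_unique rv pv w1 w3 sub1 sub3) => s2 s3.
exact: (crosses3 rv rw rz w1 s1 s3).
Qed.

(** * Distance between alcoves as the number of separating walls *)

Section Reduced.
Hypothesis sharedE : panels_shared E.

(* If no facet of the alcove of v separated v from w, then w would have
   nonnegative barycentric coordinates with respect to the vertices. *)
Lemma separating_panel v w : regular v -> regular w -> ~ cell v w ->
  exists s v' H, [/\ regular v', panel_of (cell_vertices v) s,
    panel_of (cell_vertices v') s, ~ cell v v' & [/\ is_wall phi H,
    crosses v v' H & crosses v w H]].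
Proof.
move=> rv rw nvw; apply: contrapT => noH; apply: nvw.
(* The wall opposite the vertex [p], found between the alcove and a neighbour on the panel without
   [p]; [(0, 0)] is a dummy for points that are not vertices. *)
have wallp p : exists ak : V * int, cell_vertices v p -> [/\ ak.1 \in roots phi,
    cell_vertices v `\ p `<=` hyperplane phi ak.1 ak.2 &
    0 < ('<v, ak.1> - ak.2%:~R) * ('<w, ak.1> - ak.2%:~R)].
  have [vp|nvp] := pselect (cell_vertices v p); last by exists (0, 0).
  have pv : panel_of (cell_vertices v) (cell_vertices v `\ p) by exists p.
  have cv : chamber E (cell_vertices v) by apply/chamberP; exists v.
  have [d [/chamberP[v' rv' ->] pv' dv]] := sharedE cv pv.
  have nvv' : ~ cell v v' by move=> /(cell_vertices_eq rv rv') /esym.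
  have [H wH sH] := cell_crosses rv rv' nvv'.
  have sub := crosses_panel rv rv' wH sH (panel_sub pv) (panel_sub pv').
  have nsH : ~ crosses v w H.
    by move=> sw; apply: noH; exists (cell_vertices v `\ p), v', H.
  case: wH sub nsH => a [k [ra ->]] sub nsH; exists (a, k) => _; split=> //=.
  rewrite lt_neqAle eq_sym mulf_neq0 ?regular_neq0 //= leNgt; apply/negP => h.
  by apply: nsH; apply/crossesP.
have [F FP] := choice wallp.
(* An affine function that vanishes at every vertex other than [p], so that [h p u / h p p] is the
   barycentric coordinate of [u] at [p]. *)
pose h p u := '<u, (F p).1> - (F p).2%:~R.
have hpp p : cell_vertices v p -> h p p != 0.
  move=> vp; have [rF subF _] := FP p vp.
  apply/eqP => hp0; apply: (rv (F p).1 (F p).2 rF).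
  apply: (cell_vertices_affine rv) => q vq.
  have [->|qp] := pselect (q = p); first by apply/eqP; rewrite -subr_eq0; apply/eqP.
  exact: (subF q).
have hpq p q : cell_vertices v p -> cell_vertices v q -> q != p -> h p q = 0.
  move=> vp vq /eqP qp; have [rF subF _] := FP p vp.
  by rewrite /h (subF q) // subrr.
have hw p : cell_vertices v p -> 0 < h p w / h p p.
  move=> vp; have [rF _ pos] := FP p vp; have hp := hpp p vp.
  have vp0 := cell_side (F p).2 vp.1 rF.
  move: pos vp0 hp; rewrite /h.
  set x := '<v, _> - _; set y := '<w, _> - _; set z := '<p, _> - _ => xy xz z0.
  have : 0 < y * z.
    rewrite lt_neqAle; apply/andP; split.
      rewrite eq_sym mulf_neq0 //; apply/eqP => y0; by rewrite y0 mulr0 ltxx in xy.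
    have x2 : 0 < x ^+ 2.
      rewrite exprn_even_gt0 //=; apply/eqP => x0; by rewrite x0 mul0r ltxx in xy.
    have -> : (0 <= y * z) = (0 <= x ^+ 2 * (y * z)) by rewrite (pmulr_rge0 _ x2).
    have -> : x ^+ 2 * (y * z) = (x * y) * (x * z) by ring.
    by rewrite mulr_ge0 // ltW.
  move=> yz; rewrite (_ : y / z = (y * z) / z ^+ 2); last by field.
  by rewrite divr_gt0 // exprn_even_gt0.
have [vs vsE] := finite_fsetP.1 (cell_vertices_finite v).
have vsP p : p \in vs -> cell_vertices v p by rewrite vsE.
(* Both sides are affine in [u], and at a vertex only its own term survives. Subtracting [K] inside
   the sum also encodes that the coordinates add up to 1. *)
have barycentric f (K : R) u :
    \sum_(p <- vs) h p u / h p p * (pairing p f - K) = pairing u f - K.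
  pose c p := (pairing p f - K) / h p p.
  pose g := \sum_(p <- vs) c p *: coroot phi (F p).1 - f.
  have H : (forall q, cell_vertices v q ->
      pairing q g = \sum_(p <- vs) c p * (F p).2%:~R - K) ->
    pairing u g = \sum_(p <- vs) c p * (F p).2%:~R - K.
    by move=> hq; exact: (cell_vertices_affine rv hq).
  have -> : \sum_(p <- vs) h p u / h p p * (pairing p f - K) =
      \sum_(p <- vs) pairing u (c p *: coroot phi (F p).1) -
      \sum_(p <- vs) c p * (F p).2%:~R.
    rewrite -sumrB; apply: eq_bigr => p _.
    by rewrite pairingZr /c /h; ring.
  suff /H : forall q, cell_vertices v q ->
      pairing q g = \sum_(p <- vs) c p * (F p).2%:~R - K.
    by rewrite pairingDr pairingNr pairing_sumr; lra.
  move=> q vq; rewrite pairingDr pairingNr pairing_sumr.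
  have -> : \sum_(p <- vs) pairing q (c p *: coroot phi (F p).1) =
      \sum_(p <- vs) (c p * h p q) + \sum_(p <- vs) c p * (F p).2%:~R.
    rewrite -big_split; apply: eq_bigr => p _.
    by rewrite pairingZr /h /=; ring.
  rewrite (big_fsetD1 q) /=; last by move: vq; rewrite vsE.
  rewrite big_seq big1 ?addr0; last first.
    move=> p; rewrite in_fsetD1 => /andP[pq pvs].
    by rewrite hpq ?mulr0 //; [exact: vsP|rewrite eq_sym].
  by rewrite /c divfK ?hpp //; ring.
move=> b rb; apply/andP; split.
  rewrite -subr_ge0 -barycentric big_seq sumr_ge0 // => p pvs.
  have vp := vsP p pvs; have /andP[p1 _] := vp.1 b rb.
  by rewrite mulr_ge0 ?subr_ge0 // ltW // hw.
rewrite -subr_le0 -barycentric big_seq sumr_le0 // => p pvs.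
have vp := vsP p pvs; have /andP[_ p2] := vp.1 b rb.
by rewrite mulr_ge0_le0 ?subr_le0 // ltW // hw.
Qed.

Lemma separating_walls_finite v w : exists L : seq (set V),
  forall H, is_wall phi H -> crosses v w H -> H \in L.
Proof.
pose B := \sum_(a <- enum_fset (roots phi)) (`|'<v, a>| + `|'<w, a>|).
pose M := Num.bound B.
(* At a point between [v] and [w] the pairing with a coroot has absolute value at most [B]; the
   shifted index runs over all integers from [-M] to [M]. *)
exists [seq hyperplane phi a (i%:Z - M%:Z) |
         a <- enum_fset (roots phi), i <- iota 0 (M + M).+1].
move=> _ [a [k [ra ->]]] [t /andP[t0 t1] kt].
have E : (1 - t) * '<v, a> + t * '<w, a> = k%:~R by rewrite -pairing_segment.
have kM : `|k%:~R : R| < M%:R.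
  have B0 : 0 <= B by apply: sumr_ge0 => b _; rewrite addr_ge0.
  apply: le_lt_trans (archi_boundP B0).
  rewrite /B (big_rem a ra) /= -E.
  have : 0 <= \sum_(b <- rem a (enum_fset (roots phi))) (`|'<v, b>| + `|'<w, b>|).
    by apply: sumr_ge0 => b _; rewrite addr_ge0.
  have : `|(1 - t) * '<v, a> + t * '<w, a>| <= (1 - t) * `|'<v, a>| + t * `|'<w, a>|.
    rewrite (le_trans (ler_normD _ _)) // !normrM (ger0_norm (ltW t0)).
    by rewrite (ger0_norm (_ : 0 <= 1 - t)) // subr_ge0 ltW.
  have := normr_ge0 '<v, a>; have := normr_ge0 '<w, a>.
  nra.
have {}kM : (`|k| < M%:Z)%R by rewrite -(ltr_int R) intr_norm.
apply/allpairsPdep; exists a, (absz (k + M%:Z)); split=> //.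
  by rewrite mem_iota; lia.
by congr hyperplane; lia.
Qed.

(** Crossing a separating panel removes its wall from those that separate from [w] and adds none,
    whence the induction on a list of these walls. The list [L] bounds the length of the gallery by
    their number; [gallery_crosses] is the converse bound. *)
Lemma gallery_reduced v w : regular v -> regular w ->
  exists l, [/\ gallery_path E (cell_vertices v) l,
    gallery_end (cell_vertices v) l = cell_vertices w & exists L : seq (set V),
    [/\ uniq L, size L = size l &
     forall H, H \in L -> is_wall phi H /\ crosses v w H]].
Proof.
move=> rv rw; have [L0 L0P] := separating_walls_finite v w.
have [m] := ubnP (size L0); elim: m v L0 rv L0P => // m IH v L0 rv L0P; rewrite ltnS => L0m.
have [cvw|ncvw] := pselect (cell v w).
  exists [::]; split=> //; last by exists [::].
  by apply/cell_vertices_eq.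
have [s [v' [H0 [rv' pv pv' ncvv' [wH0 sH0 vwH0]]]]] := separating_panel rv rw ncvw.
have nv'w : ~ crosses v' w H0.
  by apply: (crosses3 rv' rv rw wH0 _ vwH0); exact: (crossesC rv rv').
have v'w_vw H : is_wall phi H -> crosses v' w H -> H <> H0 /\ crosses v w H.
  move=> wH v'w; have HH0 : H <> H0 by move=> E; apply: nv'w; rewrite -E.
  split=> //; have [v'v|//] := crosses_either rv rv' rw wH v'w.
  case: HH0; have vv' := crossesC rv' rv wH v'v.
  exact: (panel_crosses_unique rv rv' pv pv' wH wH0).
have [||l [lp le [L [uL sL LP]]]] := IH v' [seq H <- L0 | H != H0] rv'.
- move=> H wH /(v'w_vw H wH) [/eqP HH0 vwH]; rewrite mem_filter HH0.
  exact: L0P.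
- apply: leq_trans L0m; rewrite size_filter -(count_predC (pred1 H0) L0).
  rewrite -add1n leq_add2r -has_count; apply/hasP; exists H0; last exact: eqxx.
  exact: L0P.
exists ((s, cell_vertices v') :: l); split=> //=.
  by split=> //; apply/chamberP; exists v'.
exists (H0 :: L); split=> //=; last 1 first.
- move=> H; rewrite in_cons => /orP[/eqP->//|/LP[wH]].
  by case/(v'w_vw H wH).
- rewrite uL andbT; apply/negP => /LP[_]; exact: nv'w.
by rewrite sL.
Qed.

(** A wall separating the ends must separate two consecutive alcoves, and each step accounts for at
    most one wall, the one through its panel. *)
Lemma gallery_crosses v w l : regular v -> regular w ->
  gallery_path E (cell_vertices v) l ->
  gallery_end (cell_vertices v) l = cell_vertices w -> exists2 L : seq (set V),
    (size L <= size l)%N &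
    forall H, is_wall phi H -> crosses v w H -> H \in L.
Proof.
move=> rv rw; elim: l v rv => [|[s d] l IH] v rv /=.
  move=> _ /(cell_vertices_eq rv rw) cvw; exists [::] => // H wH.
  by move/(cell_not_crosses rv rw wH).
move=> [/chamberP[v' rv' ->] pv pv' lp le].
have [L sL LP] := IH v' rv' lp le.
have [cvv'|ncvv'] := pselect (cell v v').
  exists L; first exact: leqW.
  move=> H wH /(crosses_either rv' rv rw wH) [|]; last exact: LP.
  by move/(cell_not_crosses rv rv' wH).
have [H0 wH0 sH0] := cell_crosses rv rv' ncvv'.
exists (H0 :: L) => //= H wH; rewrite in_cons.
move=> /(crosses_either rv' rv rw wH) [vv'|/(LP H wH) ->]; last by rewrite orbT.
by rewrite (panel_crosses_unique rv rv' pv pv' wH wH0 vv' sH0) eqxx.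
Qed.

Lemma half_ge_side v a k : regular v -> a \in roots phi ->
  cell_vertices v `<=` half_ge phi a k -> k%:~R < '<v, a>.
Proof.
move=> rv ra vge; rewrite ltNge; apply/negP => vle; apply: (rv a k ra).
apply: (cell_vertices_affine rv) => p vp.
have := cell_side k vp.1 ra; have := vge p vp; rewrite /half_ge /= => h1 h2.
have := regular_neq0 k rv ra => v0.
have vlt : '<v, a> - k%:~R < 0 by rewrite lt_neqAle v0 subr_le0.
apply/eqP; rewrite eq_le h1 andbT -subr_le0.
by rewrite -(nmulr_rge0 _ vlt).
Qed.

Lemma half_le_side v a k : regular v -> a \in roots phi ->
  cell_vertices v `<=` half_le phi a k -> '<v, a> < k%:~R.
Proof.
move=> rv ra vge; rewrite ltNge; apply/negP => vle; apply: (rv a k ra).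
apply: (cell_vertices_affine rv) => p vp.
have := cell_side k vp.1 ra; have := vge p vp; rewrite /half_le /= => h1 h2.
have := regular_neq0 k rv ra => v0.
have vlt : 0 < '<v, a> - k%:~R by rewrite lt_neqAle eq_sym v0 subr_ge0.
apply/eqP; rewrite eq_le h1 /= -subr_ge0.
by rewrite -(pmulr_rge0 _ vlt).
Qed.

(* Every gallery from c to d crosses the walls separating c from d, and these
   are the walls separating e from d together with the wall through s. *)
Lemma gallery_across_wall c d e s a k : chamber E c -> chamber E d -> chamber E e ->
  panel_of c s -> panel_of e s -> e <> c -> a \in roots phi ->
  s `<=` hyperplane phi a k ->
  c `<=` half_le phi a k /\ d `<=` half_ge phi a k \/
  c `<=` half_ge phi a k /\ d `<=` half_le phi a k ->
  exists l, [/\ gallery_path E e l, gallery_end e l = d & forall l',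
    gallery_path E c l' -> gallery_end c l' = d -> (size l < size l')%N].
Proof.
move=> /chamberP[v rv ->] /chamberP[w rw ->] /chamberP[z rz ->] pv pz.
move=> /nesym /(cell_vertices_eq rv rz) nvz ra sH sides.
have wH : is_wall phi (hyperplane phi a k) by exists a, k.
have vwH : crosses v w (hyperplane phi a k).
  apply/crossesP => //; case: sides => -[].
    move=> /(half_le_side rv ra) h1 /(half_ge_side rw ra) h2.
    by rewrite nmulr_rlt0 ?subr_lt0 ?subr_gt0.
  move=> /(half_ge_side rv ra) h1 /(half_le_side rw ra) h2.
  by rewrite pmulr_rlt0 ?subr_lt0 ?subr_gt0.
have vzH H : is_wall phi H -> crosses v z H -> H = hyperplane phi a k.
  move=> wH' sH'; apply: (panel_wall_unique rv pv) => //.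
  exact: (crosses_panel rv rz wH' sH' (panel_sub pv) (panel_sub pz)).
have [H0 wH0 sH0] := cell_crosses rv rz nvz.
have vz : crosses v z (hyperplane phi a k) by rewrite -(vzH H0).
have zvH := crossesC rv rz wH vz.
have nzw : ~ crosses z w (hyperplane phi a k).
  exact: (crosses3 rz rv rw wH zvH vwH).
have [l [lp le [L [uL sL LP]]]] := gallery_reduced rz rw.
exists l; split=> // l' l'p l'e.
have [L' sL' L'P] := gallery_crosses rv rw l'p l'e.
apply: leq_trans sL'; rewrite -sL.
apply: (@uniq_leq_size _ (hyperplane phi a k :: L)) => [/=|H].
  by rewrite uL andbT; apply/negP => /LP[].
rewrite in_cons => /orP[/eqP->|/LP[wH' zwH']]; first exact: L'P.
apply: L'P => //; have [zv|//] := crosses_either rv rz rw wH' zwH'.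
by case: nzw; rewrite -(vzH H wH') //; exact: (crossesC rz rv).
Qed.

Lemma gallery_connected c d : chamber E c -> chamber E d ->
  exists2 l, gallery_path E c l & gallery_end c l = d.
Proof.
move=> /chamberP[v rv ->] /chamberP[w rw ->].
by have [l [lp le _]] := gallery_reduced rv rw; exists l.
Qed.

End Reduced.

(** * Weyl chambers contain alcoves *)

Lemma affine_reflectionK a k : a \in roots phi ->
  involutive (affine_reflection phi a k).
Proof.
move=> ra x; rewrite /affine_reflection pairingBl pairingZl pairing_coroot //.
by apply/rowP => j; rewrite !mxE; ring.
Qed.

Lemma affine_weyl_surj g : affine_weyl phi g -> forall y, exists x, g x = y.
Proof.
elim=> [y|a k g' ra _ IH y]; first by exists y.
have [x xE] := IH (affine_reflection phi a k y).
by exists x; rewrite /= xE affine_reflectionK.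
Qed.

(** Sizes are measured by the coroots. A reflection sends a difference [x] to one whose pairing with
    its coroot is the negative of that of [x]; this controls the added multiple of [a], so undoing
    the reflection costs at most a factor [1 + N]. *)
Lemma affine_weyl_bounded g : affine_weyl phi g -> forall M : R, exists M' : R,
  forall u u', (forall b, b \in roots phi -> `|'<(g u - g u'), b>| <= M) ->
    forall b, b \in roots phi -> `|'<(u - u'), b>| <= M'.
Proof.
elim=> [M|a k g' ra _ IH M]; first by exists M.
pose N := \sum_(b <- enum_fset (roots phi)) `|'<a, b>|.
have [M' hM'] := IH (M + M * N); exists M' => u u' h; apply: hM' => b rb.
set x := g' u - g' u'.
have gE : affine_reflection phi a k (g' u) - affine_reflection phi a k (g' u') =
    x - '<x, a> *: a.
  by rewrite /affine_reflection /x pairingBl; apply/rowP => j; rewrite !mxE; ring.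
have M0 : 0 <= M by apply: le_trans (h a ra).
have xa : `|'<x, a>| <= M.
  have := h a ra; rewrite /= gE pairingBl pairingZl pairing_coroot //.
  by rewrite (_ : _ - _ = - '<x, a>) ?normrN //; ring.
have xb : `|'<x, b> - '<x, a> * '<a, b>| <= M.
  by have := h b rb; rewrite /= gE pairingBl pairingZl.
have Nb : `|'<a, b>| <= N.
  by rewrite /N (big_rem b rb) /= lerDl sumr_ge0.
have -> : '<x, b> = ('<x, b> - '<x, a> * '<a, b>) + '<x, a> * '<a, b> by ring.
apply: le_trans (ler_normD _ _) _; rewrite lerD // normrM.
exact: ler_pM.
Qed.

(** A small move in the direction of a linearly regular vector changes every coroot value, and so
    leaves all hyperplanes at once. *)
Lemma regular_near v y : linear_regular phi v -> exists2 z, regular z &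
  forall b, b \in roots phi -> `|'<(z - y), b>| <= 1.
Proof.
move=> rv.
have : \forall s \near (0 : R)^'+, forall a, a \in enum_fset (roots phi) ->
    '<y, a> + s * '<v, a> \isn't a Num.int /\ `|s * '<v, a>| <= 1.
  apply: near_right_all => a ra.
  have va : '<v, a> != 0 by apply/eqP; exact: (rv a ra).
  have : \forall s \near (0 : R)^'+, 0 < 1 + s * - `|'<v, a>|.
    exact: near_right_affine.
  apply: filterS3 (near_right_not_int '<y, a> va) (nbhs_right_gt 0) => s h s0 h'.
  by split=> //; rewrite normrM gtr0_norm //; lra.
move=> /filter_ex [s hs]; exists (y + s *: v).
  apply/regularP => a ra; rewrite pairingDl pairingZl; exact: (hs a ra).1.
by move=> b rb; rewrite addrC addKr pairingZl; exact: (hs b rb).2.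
Qed.

(* A Weyl chamber contains points arbitrarily far from its walls, and alcoves
   are bounded. *)
Lemma weyl_chamber_chamber C : weyl_chamber phi C ->
  exists2 c, chamber E c & c `<=` C.
Proof.
(* The bound 2 is 1 for replacing [g (t *: v)] by a regular point [z], plus 1 for the width of the
   alcove of [z]. *)
move=> [g [v [wg rv ->]]]; have [M hM] := affine_weyl_bounded wg 2.
(* Large enough that [t *: v] is further than [M] from every linear hyperplane. *)
pose t := \sum_(b <- enum_fset (roots phi)) (`|M| + 1) / `|'<v, b>|.
have v0 b : b \in roots phi -> 0 < `|'<v, b>|.
  by move=> rb; rewrite normr_gt0; apply/eqP; exact: (rv b rb).
have tv b : b \in roots phi -> M < t * `|'<v, b>|.
  move=> rb; rewrite -ltr_pdivrMr ?v0 // /t (big_rem b rb) /=.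
  have : M / `|'<v, b>| < (`|M| + 1) / `|'<v, b>|.
    by rewrite ltr_pM2r ?invr_gt0 ?v0 // ltr_pwDr // ler_norm.
  move=> h; apply: lt_le_trans h _; rewrite lerDl; apply: sumr_ge0 => b' _.
  by rewrite divr_ge0 // addr_ge0.
have [z rz hz] := regular_near (g (t *: v)) rv.
exists (cell_vertices z); first by apply/chamberP; exists z.
move=> u [zu _]; have [x gx] := affine_weyl_surj wg u.
exists x => //; apply: subset_closure; apply: segment_component => s /andP[s0 s1].
have near_tv b : b \in roots phi -> `|'<(x - t *: v), b>| <= M.
  apply: hM => {}b rb; rewrite gx.
  have -> : u - g (t *: v) = (u - z) + (z - g (t *: v)) by rewrite addrA subrK.
  rewrite pairingDl (le_trans (ler_normD _ _)) // -[2]/(1 + 1) lerD ?hz //.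
  have /andP[u1 u2] := zu b rb; have z1 := floor_le '<z, b>.
  have z2 := floorD1_gt '<z, b>; rewrite intrD in u2 z2.
  by rewrite pairingBl ler_norml; apply/andP; split; lra.
move=> b rb; rewrite /hyperplane /= pairing_segment => E0.
have := near_tv b rb; have := tv b rb.
rewrite pairingBl pairingZl ler_norml; move: E0.
set p := '<v, b>; set q := '<x, b> => E0 Mp /andP[q1 q2].
have [p0|p0] : 0 < p \/ p < 0.
- by apply/orP; rewrite orbC -neq_lt -normr_gt0 v0.
- have q0 : 0 < q by rewrite gtr0_norm // in Mp; lra.
  suff : 0 < (1 - s) * p + s * q by rewrite E0 ltxx.
  exact: convex_gt0.
- have q0 : q < 0 by rewrite ltr0_norm // in Mp; lra.
  suff : 0 < (1 - s) * (- p) + s * (- q) by rewrite !mulrN -opprD E0 oppr0 ltxx.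
  by apply: convex_gt0; rewrite ?oppr_gt0.
Qed.

(** Provides a chamber to which the axioms on sectors apply: the pairings with the simple coroots
    are negative at [v] and cannot become positive on the closure of its component. *)
Lemma opposite_weyl_chamber (alpha : n.-tuple V) : root_basis phi alpha ->
  exists2 C, weyl_chamber phi C & C `<=` opposite_chamber phi alpha.
Proof.
move=> balpha; have [v rv va] := antidominant_regular balpha.
exists (id @` closure (connected_component (linear_regular phi) v)).
  by exists id, v; split=> //; exact: affine_weyl_id.
move=> _ [u cu <-]; exists (- u); last by rewrite opprK.
move=> i; rewrite pairingNl oppr_ge0; apply: (component_le rv _ _ cu); first exact: va.
have [_ ra _] := balpha.
by move=> w rw; apply/eqP => w0; apply: (rw _ (ra i)); rewrite /hyperplane /= w0.
Qed.

End Arrangement.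

(** * Charts of apartments *)

Section Isomorphisms.
Variables (P Q : Type) (K : set (set P)) (L : set (set Q)) (f : P -> Q).
Hypotheses (Kdown : subsimplex_closed K) (isof : complex_iso K L f).
Implicit Types (s c : set P).

Lemma simplex_vertex s p : K s -> s p -> vertices K p.
Proof. by move=> Ks sp; apply: (Kdown Ks) => q ->. Qed.

Lemma iso_simplex s : K s -> L (f @` s).
Proof. by move=> Ks; case: isof => _ ->; exists s. Qed.

Lemma iso_simplexP t : L t -> exists2 s, K s & t = f @` s.
Proof. by case: isof => _ -> [s Ks <-]; exists s. Qed.

Lemma iso_inj p q : vertices K p -> vertices K q -> f p = f q -> p = q.
Proof. by case: isof => inj _ Kp Kq; apply: inj; rewrite inE. Qed.

Lemma iso_vertex p : vertices K p -> vertices L (f p).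
Proof. by move=> /iso_simplex; rewrite /vertices /= image_set1. Qed.

Lemma iso_vertexP q : vertices L q -> exists2 p, vertices K p & f p = q.
Proof.
move=> /iso_simplexP[s Ks sq].
have [p sp fp] : (f @` s) q by rewrite -sq.
by exists p => //; exact: simplex_vertex Ks sp.
Qed.

Lemma iso_mem s p : K s -> vertices K p -> (f @` s) (f p) -> s p.
Proof.
move=> Ks Kp [q sq fqp]; rewrite -(iso_inj _ Kp fqp) //.
exact: simplex_vertex Ks sq.
Qed.

Lemma iso_subset s t : K s -> K t -> f @` s `<=` f @` t -> s `<=` t.
Proof.
move=> Ks Kt st p sp; apply: iso_mem => //; first exact: simplex_vertex Ks sp.
by apply: st; exists p.
Qed.

Lemma iso_image_inj s t : K s -> K t -> f @` s = f @` t -> s = t.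
Proof.
by move=> Ks Kt st; apply/seteqP; split; apply: iso_subset; rewrite // st.
Qed.

Lemma iso_closed : subsimplex_closed L.
Proof.
move=> _ t /iso_simplexP[s Ks ->] ts; case: isof => _ ->.
exists (s `&` f @^-1` t); first by apply: Kdown Ks _ => p [].
apply/seteqP; split=> q; first by move=> [p [_ tp] <-].
by move=> tq; have [p sp pq] := ts _ tq; exists p => //; split; rewrite //= pq.
Qed.

Lemma iso_chamber c : chamber K c -> chamber L (f @` c).
Proof.
move=> [Kc cmax]; split=> [|_ /iso_simplexP[s Ks ->]]; first exact: iso_simplex.
by move=> /(iso_subset Kc Ks) /(cmax _ Ks) ->.
Qed.

Lemma iso_chamberP d : chamber L d -> exists2 c, chamber K c & d = f @` c.
Proof.
move=> [/[dup] Ld /iso_simplexP[c Kc ->] cmax]; exists c => //; split=> // s Ks cs.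
apply: iso_image_inj => //; apply: cmax; first exact: iso_simplex.
exact: image_subset.
Qed.

Lemma iso_panel c s : K c -> panel_of c s -> panel_of (f @` c) (f @` s).
Proof.
move=> Kc [p cp ->]; exists (f p); first by exists p.
apply/seteqP; split=> [_ [q [cq qp] <-]|_ [[q cq <-] qp]]; last first.
  by exists q => //; split=> // qp'; apply: qp; rewrite qp'.
split; first by exists q.
by move=> fqp; apply: qp; apply: iso_inj fqp; exact: simplex_vertex Kc _.
Qed.

Lemma iso_panel_inv c s : K c -> K s -> panel_of (f @` c) (f @` s) -> panel_of c s.
Proof.
move=> Kc Ks [_ [p cp <-] E]; exists p => //.
apply/seteqP; split=> q.
  move=> sq; have Kq := simplex_vertex Ks sq.
  have : (f @` c `\ f p) (f q) by rewrite -E; exists q.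
  move=> [cq qp]; split; first exact: iso_mem cq.
  by move=> qp'; apply: qp; rewrite qp'.
move=> [cq qp]; have Kq := simplex_vertex Kc cq.
apply: iso_mem => //; rewrite E; split; first by exists q.
by move=> fqp; apply: qp; apply: iso_inj fqp => //; exact: simplex_vertex Kc cp.
Qed.

Lemma iso_inverse (p0 : P) :
  exists2 g, complex_iso L K g & forall p, vertices K p -> g (f p) = p.
Proof.
have inv q : exists p, vertices L q -> vertices K p /\ f p = q.
  have [/iso_vertexP[p Kp fp]|nq] := pselect (vertices L q).
    by exists p.
  by exists p0.
have [g gP] := choice inv.
have gf p : vertices K p -> g (f p) = p.
  move=> Kp; have [Kg fg] := gP _ (iso_vertex Kp).
  exact: iso_inj fg.
exists g => //; split.
  move=> q q'; rewrite !inE => /gP[_ fg] /gP[_ fg'] E; by rewrite -fg E fg'.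
have gfs s : K s -> g @` (f @` s) = s.
  move=> Ks; rewrite image_comp; apply/seteqP; split=> p.
    by move=> [q sq <-] /=; rewrite gf //; exact: simplex_vertex Ks _.
  by move=> sp; exists p => //=; rewrite gf //; exact: simplex_vertex Ks _.
apply/seteqP; split=> s.
  by move=> Ks; exists (f @` s); [exact: iso_simplex|exact: gfs].
by move=> [t /iso_simplexP[s' Ks' ->] <-]; rewrite gfs.
Qed.

End Isomorphisms.

Lemma iso_comp (P Q S : Type) (K : set (set P)) (L : set (set Q)) (M : set (set S))
    (f : P -> Q) (g : Q -> S) : subsimplex_closed K ->
  complex_iso K L f -> complex_iso L M g -> complex_iso K M (g \o f).
Proof.
move=> Kdown isof isog; split.
  move=> p q; rewrite !inE => Kp Kq /= E.
  apply: (iso_inj isof) => //; by apply: (iso_inj isog _ _ E); exact: (iso_vertex isof).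
case: isof isog => _ -> [_ ->]; apply/seteqP; split=> s.
  by move=> [_ [t Kt <-] <-]; exists t => //; rewrite image_comp.
by move=> [t Kt <-]; exists (f @` t); [exists t|rewrite image_comp].
Qed.

Section Charts.
Variables (R : realType) (n : nat) (phi : root_system R n).
Variable X : affine_building phi.
Local Notation V := 'rV[R]_n.
Local Notation E := (coxeter_complex phi).
Local Notation K := (@bsimplex _ _ _ X).
Local Notation apartment := (@apartment _ _ _ X).
Implicit Types (f g h : V -> bpoint X) (c e s : set V) (d t : set (bpoint X)).

Definition chart f := apartment (image_complex f E) /\ set_inj (vertices E) f.

Definition agree (Q : Type) c (f g : V -> Q) := forall u, c u -> f u = g u.

Lemma agree_image (Q : Type) c (f g : V -> Q) s : agree c f g -> s `<=` c ->
  f @` s = g @` s.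
Proof.
move=> fg sc; apply/seteqP; split=> _ [u su <-]; exists u => //; [|symmetry];
by rewrite fg //; exact: sc.
Qed.

Lemma complex_down : subsimplex_closed E.
Proof. by move=> s t [c ac sc] ts; exists c => //; exact: subset_trans sc. Qed.

Lemma chart_iso f : chart f -> complex_iso E (image_complex f E) f.
Proof. by case. Qed.

Lemma iso_chart B f : apartment B -> complex_iso E B f ->
  chart f /\ B = image_complex f E.
Proof. by move=> aB [inj BE]; split=> //; split; rewrite -?BE. Qed.

Lemma chart_simplex f s : chart f -> E s -> K (f @` s).
Proof.
move=> [af inj] Es; apply: (apartment_sub af); by exists s.
Qed.

(** Take an apartment through the image of [s] and [t], and compose [f] with an isomorphism onto it
    that fixes the image of [s]. *)
Lemma chart_agree f s t : chart f -> E s -> K t -> exists g,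
  [/\ chart g, agree s g f & image_complex g E t].
Proof.
move=> cf Es Kt.
have [B [aB Bs Bt]] := apartment_exists (chart_simplex cf Es) Kt.
have fs : image_complex f E (f @` s) by exists s.
have [h [isoh hs _]] := apartment_iso cf.1 aB fs Bs fs Bs.
have [cg BE] := iso_chart aB (iso_comp complex_down (chart_iso cf) isoh).
exists (h \o f); split=> //; last by rewrite -BE.
by move=> u su; apply: hs; exists u.
Qed.

(** A larger simplex [t] lies with [d] in some apartment; mapping that apartment to [B] with [d]
    fixed puts the image of [t] above [d] in [B], so it is [d], and injectivity concludes. *)
Lemma apartment_chamber B d : apartment B -> chamber B d -> chamber K d.
Proof.
move=> aB [Bd dmax]; split=> [|t Kt dt]; first exact: (apartment_sub aB).
have [B' [aB' B'd B't]] := apartment_exists (apartment_sub aB Bd) Kt.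
have B'down : subsimplex_closed B'.
  have [f isof] := apartment_coxeter aB'; exact: (iso_closed complex_down isof).
have [h [isoh hd _]] := apartment_iso aB' aB B'd Bd B'd Bd.
have hdd : h @` d = d.
  apply/seteqP; split=> [_ [p dp <-]|p dp]; first by rewrite hd.
  by exists p => //; exact: hd.
apply: (iso_image_inj B'down isoh B't B'd); rewrite hdd; apply: dmax.
  exact: (iso_simplex isoh).
by rewrite -hdd; exact: image_subset.
Qed.

Lemma chart_chamber f c : chart f -> chamber E c -> chamber K (f @` c).
Proof.
move=> cf cc; apply: (apartment_chamber cf.1).
exact: (iso_chamber complex_down (chart_iso cf)).
Qed.

Lemma chart_chamberP f d : chart f -> image_complex f E d -> chamber K d ->
  exists2 c, chamber E c & d = f @` c.
Proof.
move=> cf fd [Kd dmax]; apply: (iso_chamberP complex_down (chart_iso cf)).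
split=> // t ft; apply: dmax; exact: (apartment_sub cf.1).
Qed.

Lemma chart_chamber_exists f c d : chart f -> chamber E c -> chamber K d ->
  exists g e, [/\ chart g, agree c g f, chamber E e & d = g @` e].
Proof.
move=> cf cc cd; have [g [cg ag gd]] := chart_agree cf cc.1 cd.1.
by have [e ce ->] := chart_chamberP cg gd cd; exists g, e.
Qed.

Lemma chart_adjacent f c s d : chart f -> chamber E c -> panel_of c s ->
  chamber K d -> panel_of d (f @` s) -> exists g e,
  [/\ chart g, agree c g f, chamber E e, panel_of e s & d = g @` e].
Proof.
move=> cf cc pc cd pd.
have [g [e [cg ag ce de]]] := chart_chamber_exists cf cc cd.
exists g, e; split=> //; apply: (iso_panel_inv complex_down (chart_iso cg)).
- exact: ce.1.
- by apply: complex_down cc.1 _; exact: panel_sub.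
- by rewrite -de (agree_image ag (panel_sub pc)).
Qed.

(** Thickness gives another chamber on the image of the panel; a chart through it that agrees with
    [f] on [c] exhibits it as an alcove of E. *)
Lemma panels_shared_complex f : chart f -> panels_shared E.
Proof.
move=> cf c s cc pc.
have [d [_ [[cd pd] _ [dc _ _]]]] := building_thick (chart_chamber cf cc)
  (iso_panel complex_down (chart_iso cf) cc.1 pc).
have [g [e [cg ag ce pe de]]] := chart_adjacent cf cc pc cd pd.
exists e; split=> // ec; apply: dc; rewrite de ec.
by apply: (agree_image ag).
Qed.

End Charts.
Arguments complex_down {R n phi} [s t].

(** * Rigidity of charts, and retractions centered at an alcove *)

Section Retractions.
Variables (R : realType) (n : nat) (phi : root_system R n).
Variable X : affine_building phi.
Local Notation V := 'rV[R]_n.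
Local Notation E := (coxeter_complex phi).
Local Notation K := (@bsimplex _ _ _ X).
Implicit Types (f g h : V -> bpoint X) (r : bpoint X -> V) (u : V).
Implicit Types (c : set V).

Lemma chamber_vertex c u : chamber E c -> c u -> vertices E u.
Proof. by move=> cc; apply: (simplex_vertex complex_down); exact: cc.1. Qed.

Lemma vertex_chamber u : vertices E u -> exists2 c, chamber E c & c u.
Proof.
move=> /complexP[v rv sv]; exists (cell_vertices phi v).
  by apply/chamberP; exists v.
exact: sv.
Qed.

Lemma panel_simplex c s : chamber E c -> panel_of c s -> E s.
Proof. by move=> cc pc; apply: (complex_down cc.1); exact: panel_sub. Qed.

Section Connectedness.
Variable f0 : V -> bpoint X.
Hypothesis chart0 : chart f0.

Lemma chamber_propagate (P : set V -> Prop) c : chamber E c -> P c ->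
  (forall d e s, chamber E d -> chamber E e -> d <> e -> panel_of d s -> panel_of e s ->
    P d -> P e) -> forall d, chamber E d -> P d.
Proof.
move=> cc Pc step d cd.
have [l lp <-] := gallery_connected (panels_shared_complex chart0) cc cd.
elim: l c cc Pc lp => [|[s e] l IH] c cc Pc //= [ce pc pe lp].
apply: IH lp => //; have [<-|nce] := pselect (c = e); first by [].
exact: (step c e s cc ce nce pc pe Pc).
Qed.

(** Agreement passes to a neighbour [e] of [d]: the alcove that [g] maps onto the [f]-image of [e]
    contains the common panel and is not [d], so it is [e] by [thin]. Only the vertex off the panel
    then remains, and its image is forced. *)
Lemma chart_unique f g c : chart f -> chart g -> image_complex f E = image_complex g E ->
  chamber E c -> agree c f g -> forall u, vertices E u -> f u = g u.
Proof.
move=> cf cg fgE cc ag u /vertex_chamber[d cd]; move: d cd u.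
apply: (chamber_propagate cc ag) => d e s cd ce nde pd pe dfg.
have isof := chart_iso cf; have isog := chart_iso cg.
have sfg : f @` s = g @` s := agree_image dfg (panel_sub pd).
have [e' ce' fe] : exists2 e', chamber E e' & f @` e = g @` e'.
  apply: (iso_chamberP complex_down isog); rewrite -fgE.
  exact: (iso_chamber complex_down isof).
have pe' : panel_of e' s.
  apply: (iso_panel_inv complex_down isog); [exact: ce'.1|exact: panel_simplex pe|].
  rewrite -fe -sfg; exact: (iso_panel complex_down isof ce.1).
have e'd : e' <> d.
  move=> E; apply: nde; apply: (iso_image_inj complex_down isof); [exact: cd.1|exact: ce.1|].
  by rewrite fe E; apply: (agree_image dfg).
have ee' : e = e' by apply: (thin cd ce ce' pd pe pe') => //; exact: nesym.
move=> u eu; case: pe => q eq sE.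
have [su|nsu] := pselect (s u); first by apply: dfg; exact: panel_sub pd _ su.
have [u' eu' fu] : (g @` e) (f u) by rewrite [in g @` _]ee' -fe; exists u.
have uq : u = q.
  by apply: contrapT => uq; apply: nsu; rewrite sE.
have [u'q|u'q] := pselect (u' = q); first by rewrite -fu u'q uq.
have su' : s u' by rewrite sE.
case: nsu; rewrite -(iso_inj isof _ _ (_ : f u' = f u)) //.
- exact: chamber_vertex eu'.
- exact: chamber_vertex eu.
- by rewrite -fu; apply: dfg; exact: panel_sub pd _ su'.
Qed.

(* The retraction onto E centered at c is encoded as the common left inverse of
   all charts that agree with f on c. *)
Definition centered c f r := forall g, chart g -> agree c g f ->
  forall u, vertices E u -> r (g u) = u.

(** The value at [x] is read off in any chart through [x] that agrees with [f] on [c]. Two such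
    charts differ by an isomorphism fixing [x] and the image of [c], so [chart_unique] makes the
    value independent of the choice. *)
Lemma retraction_exists f c : chart f -> chamber E c -> exists r, centered c f r.
Proof.
move=> cf cc.
have val x : exists u, forall g u', chart g -> agree c g f -> vertices E u' ->
    g u' = x -> u' = u.
  have [g [cg ag gx]] := chart_agree cf cc.1 (bsimplex_vertex x).
  have [u Eu gu] := iso_vertexP complex_down (chart_iso cg) gx.
  exists u => g' u' cg' ag' Eu' gu'.
  have gc : image_complex g E (g @` c) by exists c => //; exact: cc.1.
  have g'g : agree c g' g by move=> y cy; rewrite ag' // ag.
  have g'c : image_complex g' E (g @` c).
    by exists c; [exact: cc.1|exact: (agree_image g'g)].
  have g'x : image_complex g' E [set x].
    by exists [set u'] => //; rewrite image_set1 gu'.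
  have [h [isoh hc hx]] := apartment_iso cg.1 cg'.1 gc g'c gx g'x.
  have isohg := iso_comp complex_down (chart_iso cg) isoh.
  have [chg imE] := iso_chart cg'.1 isohg.
  have hgg' : agree c (h \o g) g'.
    by move=> y cy /=; rewrite hc ?g'g //; exists y.
  have := chart_unique chg cg' (esym imE) cc hgg' Eu.
  rewrite /= gu hx // -gu'.
  exact: (iso_inj (chart_iso cg') Eu' Eu).
have [r rP] := choice val; exists r => g cg ag u Eu.
by apply/esym/(rP _ g).
Qed.

Section Types.
Variables (T : Type) (tau : bpoint X -> T).
Hypothesis labtau : labelling K tau.

Definition same_type f g := forall u, vertices E u -> tau (f u) = tau (g u).

(** Along a gallery from [c]: the types on a panel determine the type of the vertex completing it to
    an alcove, since a labelling is bijective on chambers. *)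
Lemma chart_type f g c : chart f -> chart g -> chamber E c -> agree c f g ->
  same_type f g.
Proof.
move=> cf cg cc ag u /vertex_chamber[d cd]; move: d cd u.
have agt : forall u, c u -> tau (f u) = tau (g u) by move=> u cu; rewrite ag.
apply: (chamber_propagate cc agt) => d e s cd ce nde pd [q eq sE] dfg u eu.
have stype y : s y -> tau (f y) = tau (g y).
  by move=> sy; apply: dfg; exact: panel_sub pd _ sy.
have [uq|uq] := pselect (u = q); last by apply: stype; rewrite sE.
have [_ _ surjf] := labtau (chart_chamber cf ce).
have [_ [y ey <-] ty] := surjf (tau (g u)) I.
have [uy|yu] := pselect (u = y); first by rewrite -ty uy.
have sy : s y by rewrite sE; split=> // yq; apply: yu; rewrite uq.
have [_ injg _] := labtau (chart_chamber cg ce).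
case: yu; apply: (iso_inj (chart_iso cg));
  [exact: chamber_vertex eu|exact: chamber_vertex ey|].
apply: injg; rewrite ?inE; [by exists u|by exists y|by rewrite -ty stype].
Qed.

Lemma type_inj d x y : chamber K d -> d x -> d y -> tau x = tau y -> x = y.
Proof. by move=> /labtau[_ inj _] dx dy; apply: inj; rewrite inE. Qed.

(* Thickness provides a third chamber on the panel, and two apartments through
   it exchange the two chambers of E on that panel. *)
Lemma chart_transport f c d : chart f -> chamber E c -> chamber K d ->
  exists g, [/\ chart g, g @` c = d & same_type g f].
Proof.
move=> cf cc cd.
have [g0 [e0 [cg0 ag0 ce0 dE]]] := chart_chamber_exists cf cc cd.
have P0 : exists g, [/\ chart g, g @` e0 = d & same_type g f].
  by exists g0; split=> //; exact: chart_type cc ag0.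
move: c cc {ag0}; apply: (chamber_propagate ce0 P0) => e e' s ce ce' nee' pe pe'.
move=> [h [ch he ht]].
have ps : panel_of d (h @` s).
  by rewrite -he; exact: (iso_panel complex_down (chart_iso ch) ce.1).
have [d3 [cd3 pd3 d3d d3h]] : exists d3, [/\ chamber K d3, panel_of d3 (h @` s),
    d3 <> d & d3 <> h @` e'].
  have [d1 [d2 [[cd1 pd1] [cd2 pd2] [d1d d2d d12]]]] := building_thick cd ps.
  have [d1h|d1h] := pselect (d1 = h @` e'); last by exists d1.
  by exists d2; split=> // d2h; apply: d12; rewrite d1h.
(* [h1] keeps [h] on [e'] and sends [e] to [d3]; then [h2] keeps [h1] on [e] and sends [e'] to
   [d]. *)
have [h1 [e1 [ch1 ag1 ce1 pe1 d3E]]] := chart_adjacent ch ce' pe' cd3 pd3.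
have e1e : e1 = e.
  apply: (thin ce' ce1 ce pe' pe1 pe) => // e1e'; apply: d3h.
  by rewrite d3E e1e'; apply: (agree_image ag1).
have h1s : h1 @` s = h @` s := agree_image ag1 (panel_sub pe').
rewrite -h1s in ps.
have [h2 [e2 [ch2 ag2 ce2 pe2 dE2]]] := chart_adjacent ch1 ce pe cd ps.
have e2e' : e2 = e'.
  apply: (thin ce ce2 ce' pe pe2 pe') => [e2e|]; last exact: nesym.
  apply: d3d; rewrite dE2 d3E e1e e2e; apply/esym; exact: (agree_image ag2).
exists h2; split=> // [|u Eu]; first by rewrite dE2 e2e'.
by rewrite (chart_type ch2 ch1 ce ag2) // (chart_type ch1 ch ce' ag1) // ht.
Qed.

End Types.
End Connectedness.

(** What the retractions centered at an alcove share with the one centered at infinity; it suffices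
    for projecting galleries to E. *)
Definition folding r := forall d, chamber K d -> exists g c,
  [/\ chart g, chamber E c, d = g @` c & forall u, vertices E u -> r (g u) = u].

Lemma centered_chart f c r d : chart f -> chamber E c -> centered c f r ->
  chamber K d -> exists g e, [/\ chart g, agree c g f, chamber E e, d = g @` e
    & forall u, vertices E u -> r (g u) = u].
Proof.
move=> cf cc rP cd.
have [g [e [cg ag ce dE]]] := chart_chamber_exists cf cc cd.
by exists g, e; split=> //; exact: rP.
Qed.

Lemma centered_folding f c r : chart f -> chamber E c -> centered c f r -> folding r.
Proof.
move=> cf cc rP d cd.
by have [g [e [cg _ ce dE gP]]] := centered_chart cf cc rP cd; exists g, e.
Qed.

Lemma section_image r g s : (forall u, vertices E u -> r (g u) = u) ->
  E s -> r @` (g @` s) = s.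
Proof.
move=> gP Es; rewrite image_comp; apply/seteqP; split=> [_ [u su <-]|u su] /=.
  by rewrite gP //; exact: (simplex_vertex complex_down Es).
exists u => //=; rewrite gP //; exact: (simplex_vertex complex_down Es).
Qed.

Lemma folding_chamber r d : folding r -> chamber K d -> chamber E (r @` d).
Proof.
move=> fr /fr[g [c [cg cc -> gP]]].
by rewrite (section_image gP) //; exact: cc.1.
Qed.

Lemma folding_panel r d t : folding r -> chamber K d -> panel_of d t ->
  panel_of (r @` d) (r @` t).
Proof.
move=> fr /fr[g [c [cg cc -> gP]]] [_ [p cp <-] ->].
have Ep := chamber_vertex cc cp.
exists p; first by exists (g p); [exists p|exact: gP].
rewrite (section_image gP cc.1).
apply/seteqP; split=> [_ [_ [[u cu <-] up] <-]|u [cu up]].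
  have Eu := chamber_vertex cc cu; rewrite gP //; split=> // uE.
  by apply: up; rewrite /= uE.
have Eu := chamber_vertex cc cu.
exists (g u); last exact: gP; split; first by exists u.
by move=> gup; apply: up; rewrite /= -(gP u) // gup gP.
Qed.

Lemma folding_path r d l : folding r -> chamber K d -> gallery_path K d l ->
  gallery_path E (r @` d) (map_path r l).
Proof.
move=> fr; elim: l d => //= x l IH d cd [cx px px' lp]; split.
- exact: folding_chamber.
- exact: folding_panel.
- exact: folding_panel.
- exact: IH.
Qed.

Lemma chart_path f c l : chart f -> chamber E c -> gallery_path E c l ->
  gallery_path K (f @` c) (map_path f l).
Proof.
move=> cf; elim: l c => //= x l IH c cc [cx px px' lp]; split.
- exact: chart_chamber.
- by apply: (iso_panel complex_down (chart_iso cf)) px; exact: cc.1.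
- by apply: (iso_panel complex_down (chart_iso cf)) px'; exact: cx.1.
- exact: IH.
Qed.

End Retractions.

(** * Lifting and minimality *)

Section Unfolding.
Variables (R : realType) (n : nat) (phi : root_system R n).
Variable X : affine_building phi.
Local Notation V := 'rV[R]_n.
Local Notation E := (coxeter_complex phi).
Local Notation K := (@bsimplex _ _ _ X).
Implicit Types (f g h : V -> bpoint X) (r : bpoint X -> V) (u v : V).

Lemma centered_neq f c r d : chart f -> chamber E c -> centered c f r ->
  chamber K d -> d <> f @` c -> r @` d <> c.
Proof.
move=> cf cc rP cd dc; have [g [e [cg ag ce dE gP]]] := centered_chart cf cc rP cd.
rewrite dE (section_image gP ce.1) => ec; apply: dc.
by rewrite dE ec; apply: (agree_image ag).
Qed.

Lemma section_retract r g e (t : set (bpoint X)) : (forall u, vertices E u -> r (g u) = u) ->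
  chamber E e -> t `<=` g @` e -> g @` (r @` t) = t.
Proof.
move=> gP ce te; apply/seteqP; split=> [_ [_ [x tx <-] <-]|x tx].
  have [u eu gu] := te x tx; rewrite -gu gP ?gu //; exact: chamber_vertex eu.
exists (r x); first by exists x.
by have [u eu gu] := te x tx; rewrite -gu gP //; exact: chamber_vertex eu.
Qed.

Section Types.
Variables (T : Type) (tau : bpoint X -> T).
Hypothesis labtau : labelling K tau.

Definition typed f r := forall d x, chamber K d -> d x -> tau (f (r x)) = tau x.

Lemma centered_typed f c r : chart f -> chamber E c -> centered c f r -> typed f r.
Proof.
move=> cf cc rP d x cd; have [g [e [cg ag ce dE gP]]] := centered_chart cf cc rP cd.
rewrite dE => -[u eu <-]; have Eu := chamber_vertex ce eu; rewrite gP //.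
by apply/esym/(chart_type cf labtau cg cf cc ag).
Qed.

Lemma typed_image f r d (t : set (bpoint X)) : typed f r -> chamber K d -> t `<=` d ->
  tau @` (f @` (r @` t)) = tau @` t.
Proof.
move=> fr cd td; rewrite !image_comp; apply: eq_imagel => x tx /=.
by apply: (fr d x) => //; exact: td.
Qed.

Lemma typed_path f r c l : typed f r -> chamber K c -> gallery_path K c l ->
  [seq tau @` (f @` s) | s <- unzip1 (map_path r l)] = [seq tau @` s | s <- unzip1 l].
Proof.
move=> fr; elim: l c => [|x l IH] c cc //= [cx px px' lp].
by rewrite (typed_image fr cc (panel_sub px)) (IH x.2).
Qed.

Lemma type_image_inj f c s t : chart f -> chamber E c -> s `<=` c -> t `<=` c ->
  tau @` (f @` s) = tau @` (f @` t) -> s = t.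
Proof.
move=> cf cc.
suff sub s' t' : s' `<=` c -> t' `<=` c -> tau @` (f @` s') = tau @` (f @` t') ->
    s' `<=` t'.
  by move=> sc tc st; apply/seteqP; split; apply: sub.
move=> sc tc st u su.
have [_ [v tv <-] tuv] : (tau @` (f @` t')) (tau (f u)).
  by rewrite -st; exists (f u) => //; exists u.
have fuv : f v = f u.
  apply: (type_inj labtau (chart_chamber cf cc)) tuv.
    by exists v => //; exact: tc.
  by exists u => //; exact: sc.
rewrite -(iso_inj (chart_iso cf) _ _ fuv) //.
  exact: (chamber_vertex cc (tc _ tv)).
exact: (chamber_vertex cc (sc _ su)).
Qed.

(* The retraction centered at the first chamber cannot fold a gallery of the
   type of lE: at a first fold, retracting from the folded chamber instead gives
   a gallery in E which is shorter than lE. *)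
Lemma nonstuttering_retracts f c r lE u0 u1 l : chart f -> chamber E c ->
  centered c f r -> gallery_path E c lE -> c u0 -> gallery_end c lE u1 ->
  minimal_length E u0 u1 (size lE) ->
  gallery_path K (f @` c) l -> nonstuttering (f @` c) l ->
  [seq tau @` s | s <- unzip1 l] = [seq tau @` (f @` s) | s <- unzip1 lE] ->
  map_path r l = lE.
Proof.
move=> cf cc rP lEp cu0 eu1 minE.
have fr := centered_folding cf cc rP.
have tr := centered_typed cf cc rP.
have cfc := chart_chamber cf cc.
have rfc : r @` (f @` c) = c by apply: section_image cc.1; exact: rP.
(* [l1] is the initial part already known to retract onto an initial part of [lE]. *)
suff H l1 : forall l2 lE2, lE = map_path r l1 ++ lE2 ->
    gallery_path K (f @` c) l1 -> gallery_path K (gallery_end (f @` c) l1) l2 ->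
    nonstuttering (gallery_end (f @` c) l1) l2 ->
    [seq tau @` s | s <- unzip1 l2] = [seq tau @` (f @` s) | s <- unzip1 lE2] ->
    map_path r l2 = lE2.
  by move=> lp ns ts; exact: (H [::] l lE).
move=> l2; elim: l2 l1 => [|[t d] l2 IH] l1 [|[s e] lE2] //= lEE l1p.
set a := gallery_end (f @` c) l1 => -[cd pat pdt l2p] [da ns] [ts tl].
have ca : chamber K a by exact: gallery_end_chamber l1p.
have raE : gallery_end c (map_path r l1) = r @` a by rewrite -rfc map_path_end.
have cra := folding_chamber fr ca.
move: (lEp); rewrite lEE => /gallery_path_cat[rl1p /=].
rewrite raE => -[ce pras pes lE2p].
have prat := folding_panel fr ca pat.
have rts : r @` t = s.
  apply: (type_image_inj cf cra (panel_sub prat) (panel_sub pras)).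
  by rewrite (typed_image tr ca (panel_sub pat)).
(* Such an [l'], continued by [lE2], would reach the end of [lE] in one step less. *)
have too_short l' : gallery_path E c l' -> gallery_end c l' = e -> size l' <> size l1.
  move=> l'p l'e sl'.
  have := minE c (l' ++ lE2) cc.
  rewrite gallery_path_cat gallery_end_cat l'e => /(_ (conj l'p lE2p) cu0).
  have -> : gallery_end e lE2 = gallery_end c lE.
    by rewrite lEE gallery_end_cat /gallery_end.
  move=> /(_ eu1); rewrite lEE !size_cat /= size_map_path sl'.
  by rewrite leq_add2l ltnn.
have era : e <> r @` a.
  by move=> era; apply: (too_short (map_path r l1)); rewrite ?raE ?size_map_path.
have crd := folding_chamber fr cd.
have prd : panel_of (r @` d) s by rewrite -rts; exact: folding_panel.
have rde : r @` d = e.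
  have [rda|rda] := pselect (r @` d = r @` a); last exact: (thin cra crd ce pras prd pes).
  have [h [e0 [ch ah ce0 dE hP]]] := centered_chart cf cc rP cd.
  have {}dE : d = h @` (r @` a).
    by rewrite -rda dE (section_image hP ce0.1).
  (* Center the retraction at [d] instead. It sends [a], which differs from [d], to the other alcove
     [e] on [s] and the first alcove still to [c], so the image of [l1] reaches [e] one step too
     early. *)
  have [r' r'P] := retraction_exists cf ch cra.
  have fr' := centered_folding ch cra r'P.
  have r'ra := centered_neq ch cra r'P ca.
  have thE : h @` s = t.
    rewrite -rts; apply: (section_retract hP cra); rewrite -dE; exact: panel_sub.
  have r'hP : forall u, vertices E u -> r' (h u) = u by exact: r'P.
  have r'ae : r' @` a = e.
    apply: (thin cra (folding_chamber fr' ca) ce pras _ pes) => //.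
      rewrite -(section_image r'hP (panel_simplex cra pras)) thE.
      exact: folding_panel.
    by apply: r'ra => ad; apply: da; rewrite dE -ad.
  case: (too_short (map_path r' l1)); last exact: size_map_path.
    have -> : c = r' @` (f @` c).
      rewrite -(agree_image ah (s := c)) //.
      by rewrite (section_image r'hP cc.1).
    exact: folding_path.
  have -> : c = r' @` (f @` c).
    by rewrite -(agree_image ah (s := c)) // (section_image r'hP cc.1).
  by rewrite map_path_end.
rewrite rts rde; congr (_ :: _).
apply: (IH (rcons l1 (t, d))); rewrite ?/gallery_end /unzip2 ?map_rcons ?last_rcons //.
  by rewrite lEE /map_path map_rcons cat_rcons /= rts rde.
by rewrite -cats1; apply/gallery_path_cat.
Qed.

End Types.
End Unfolding.

(** * Transfer of minimality between X and E *)

Section Minimality.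
Variables (R : realType) (n : nat) (phi : root_system R n).
Variable X : affine_building phi.
Local Notation V := 'rV[R]_n.
Local Notation E := (coxeter_complex phi).
Local Notation K := (@bsimplex _ _ _ X).
Implicit Types (f g h : V -> bpoint X) (r : bpoint X -> V) (u v : V).
Variables (T : Type) (tau : bpoint X -> T).
Hypothesis labtau : labelling K tau.

(** Retract from the first alcove of [delta], and choose [g] through its first and last alcoves. A
    shorter gallery in E with the same ends would be carried by [g] to one shorter than [delta]. *)
Lemma minimal_gallery_chart f0 (delta : gallery (bpoint X)) : chart f0 ->
  minimal_gallery K delta -> exists g c l u0 u1,
  [/\ chart g, chamber E c & gallery_path E c l] /\
  [/\ c u0, gallery_end c l u1, g u0 = gsource delta, g u1 = gtarget delta
   & minimal_length E u0 u1 (size l)] /\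
  [seq tau @` (g @` s) | s <- unzip1 l] = [seq tau @` s | s <- unzip1 (gsteps delta)].
Proof.
move=> cf0 /minimal_galleryP[/is_galleryP[cd ds dt dp] dmin].
have [f [c [cf cc dE]]] : exists f c, [/\ chart f, chamber E c & ghead delta = f @` c].
  have [B [aB Bd _]] := apartment_exists cd.1 cd.1.
  have [f isof] := apartment_coxeter aB; have [cf BE] := iso_chart aB isof.
  rewrite BE in Bd; have [c cc dE] := chart_chamberP cf Bd cd.
  by exists f, c.
have [r rP] := retraction_exists cf cf cc.
have fr := centered_folding cf cc rP.
have ce := gallery_end_chamber cd dp.
have [g [e [cg ag ce' eE gP]]] := centered_chart cf cc rP ce.
have dE' : ghead delta = g @` c by rewrite dE; apply/esym; exact: (agree_image ag).
have rd : r @` ghead delta = c by rewrite dE' (section_image gP cc.1).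
move: ds dt; rewrite eE dE' => -[u0 cu0 gu0] [u1 eu1 gu1].
exists g, c, (map_path r (gsteps delta)), u0, u1; split; [|split; [split=> //|]].
- by split=> //; rewrite -[c in gallery_path E c]rd; exact: folding_path.
- by rewrite -[c in gallery_end c]rd map_path_end eE (section_image gP ce'.1).
- rewrite size_map_path => c' l cc' lp c'u0 lu1.
  rewrite -(size_map_path g l); apply: (dmin (g @` c')).
  + exact: chart_chamber.
  + exact: chart_path.
  + by exists u0.
  + by rewrite map_path_end; exists u1.
- suff tr : typed tau g r by exact: (typed_path tr cd dp).
  move=> d x cd' dx.
  rewrite -(centered_typed labtau cf cc rP cd' dx).
  have [h [e' [ch ah ce'' dE'' hP]]] := centered_chart cf cc rP cd'.
  apply: (chart_type cf labtau cg cf cc ag).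
  by move: dx; rewrite dE'' => -[u /(chamber_vertex ce'') Eu <-]; rewrite hP.
Qed.

Lemma same_type_path f g c l : same_type tau f g -> chamber E c ->
  gallery_path E c l ->
  [seq tau @` (f @` s) | s <- unzip1 l] = [seq tau @` (g @` s) | s <- unzip1 l].
Proof.
move=> fg; elim: l c => [|x l IH] c cc //= [cx px px' lp].
congr (_ :: _); last exact: (IH x.2).
rewrite !image_comp; apply: eq_imagel => u /(panel_sub px) cu.
exact/fg/(chamber_vertex cc).
Qed.

(** The retraction from the first alcove maps [gamma] onto [lE], and a competitor to a gallery of E
    with the same ends. That the target goes to [u1] follows from its type, as both lie in the last
    alcove. *)
Lemma same_type_minimal f c lE u0 u1 (gamma : gallery (bpoint X)) :
  chart f -> chamber E c -> gallery_path E c lE -> c u0 -> gallery_end c lE u1 ->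
  minimal_length E u0 u1 (size lE) ->
  is_gallery K gamma -> ghead gamma = f @` c -> gsource gamma = f u0 ->
  nonstuttering (ghead gamma) (gsteps gamma) ->
  [seq tau @` s | s <- unzip1 (gsteps gamma)] =
    [seq tau @` (f @` s) | s <- unzip1 lE] ->
  tau (gtarget gamma) = tau (f u1) -> minimal_gallery K gamma.
Proof.
move=> cf cc lEp cu0 eu1 minE isg; have /is_galleryP[cg _ gt gp] := isg.
move=> hE sE ns types tt.
have [r rP] := retraction_exists cf cf cc.
have fr := centered_folding cf cc rP.
rewrite hE in ns gp gt cg.
have lE' := nonstuttering_retracts labtau cf cc rP lEp cu0 eu1 minE gp ns types.
have rc : r @` (f @` c) = c by exact: (section_image (rP f cf (fun _ _ => erefl)) cc.1).
have rs : r (gsource gamma) = u0.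
  by rewrite sE (rP f) //; exact: chamber_vertex cu0.
have ce := gallery_end_chamber cg gp.
have reE : r @` gallery_end (f @` c) (gsteps gamma) = gallery_end c lE.
  by rewrite -map_path_end lE' rc.
have ceE : chamber E (gallery_end c lE) by exact: gallery_end_chamber lEp.
have rt : r (gtarget gamma) = u1.
  have ert : gallery_end c lE (r (gtarget gamma)).
    by rewrite -reE; exists (gtarget gamma).
  apply: (iso_inj (chart_iso cf)); [exact: chamber_vertex ert|exact: chamber_vertex eu1|].
  apply: (type_inj labtau (chart_chamber cf ceE)).
  - by exists (r (gtarget gamma)).
  - by exists u1.
  by rewrite (centered_typed labtau cf cc rP ce gt).
apply/minimal_galleryP; split=> // c' l' cc' l'p c's l't.
rewrite -(size_map_path r (gsteps gamma)) lE' -(size_map_path r l').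
apply: (minE (r @` c')).
- exact: folding_chamber.
- exact: folding_path.
- by exists (gsource gamma).
- by rewrite map_path_end; exists (gtarget gamma).
Qed.

End Minimality.

(** * The retraction centered at infinity, and lifting along it *)

Section RetractionAtInfinity.
Variables (R : realType) (n : nat) (phi : root_system R n).
Variable X : affine_building phi.
Local Notation V := 'rV[R]_n.
Local Notation E := (coxeter_complex phi).
Local Notation K := (@bsimplex _ _ _ X).
Local Notation apartment := (@apartment _ _ _ X).
Implicit Types (f g h : V -> bpoint X) (u v : V).
Variables (A : set (set (bpoint X))) (iota : V -> bpoint X) (C : set V)
  (rho : bpoint X -> V).
Hypotheses (aptA : apartment A) (isoA : complex_iso E A iota)
  (retr : retraction_at_infinity A iota C rho).

Lemma chart_iota : chart iota.
Proof. exact: (iso_chart aptA isoA).1. Qed.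

Lemma imageA : A = image_complex iota E.
Proof. by case: isoA. Qed.

Definition sector_of (S : set V) := image_complex iota (subcomplex_in E S).

Lemma sector_iota S : weyl_chamber phi S -> sector phi apartment (sector_of S).
Proof. by move=> wS; exists A, iota, S. Qed.

Lemma sector_chamber S : sector phi apartment S -> exists2 D, chamber K D & S D.
Proof.
move=> [B [f [S' [aB isof wS' ->]]]].
have [c cc cS'] := weyl_chamber_chamber wS'.
exists (f @` c); first exact: chart_chamber (iso_chart aB isof).1 cc.
by exists c => //; split=> //; exact: cc.1.
Qed.

(** Inverts [rho] on an apartment containing [D] and a subsector of [S]. The subsector is returned
    so that a second application inside it gives a chart sharing alcoves with the first. *)
Lemma rho_chart S D : sector phi apartment S -> S `<=` sector_of C -> chamber K D ->
  exists g e S', [/\ chart g, chamber E e, D = g @` e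
    & forall u, vertices E u -> rho (g u) = u]
  /\ [/\ sector phi apartment S', S' `<=` S
   & forall d, E d -> S' (iota @` d) -> agree d g iota].
Proof.
move=> sS SC cD.
have [B [S' [aB BD [sS' S'S S'B]]]] := chamber_sector_apartment cD sS.
have [isoB rhoA] := retr.2 B S' aB sS' (subset_trans S'S SC) S'B.
have Bdown : subsimplex_closed B.
  by have [f isof] := apartment_coxeter aB; exact: (iso_closed complex_down isof).
have [g isog gP] := iso_inverse Bdown isoB (iota 0).
have [cg BE] := iso_chart aB isog.
have rhog u : vertices E u -> rho (g u) = u.
  by move=> /(iso_vertexP Bdown isoB)[p Bp <-]; rewrite gP.
have gD : image_complex g E D by rewrite -BE.
have [e ce DE] := chart_chamberP cg gD cD.
exists g, e, S'; split; split=> // d Ed S'd u du.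
have Eu := simplex_vertex complex_down Ed du.
have Bu : vertices B (iota u).
  by apply: (simplex_vertex Bdown (S'B _ S'd)); exists u.
by rewrite -[in LHS](rhoA u Eu Bu) gP.
Qed.

Variable C0 : set V.
Hypotheses (weylC0 : weyl_chamber phi C0) (subC0 : C0 `<=` C).

Lemma sector_of_sub S : S `<=` C -> sector_of S `<=` sector_of C.
Proof.
move=> SC _ [s [Es sS] <-]; exists s => //; split=> //; exact: subset_trans SC.
Qed.

Lemma rho_iota u : vertices E u -> rho (iota u) = u.
Proof.
move=> Eu; have SA : sector_of C0 `<=` A.
  by rewrite imageA => _ [s [Es _] <-]; exists s.
have [_ rhoA] := retr.2 A _ aptA (sector_iota weylC0) (sector_of_sub subC0) SA.
by apply: rhoA => //; exact: (iso_vertex isoA).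
Qed.

Lemma rho_folding : folding rho.
Proof.
move=> D cD.
have [g [e [_ [[cg ce DE gP] _]]]] := rho_chart (sector_iota weylC0) (sector_of_sub subC0) cD.
by exists g, e.
Qed.

Lemma sector_of_chamber S S' : weyl_chamber phi S -> sector phi apartment S' ->
  S' `<=` sector_of S -> exists d, [/\ chamber E d, d `<=` S & S' (iota @` d)].
Proof.
move=> wS sS' S'S; have [D cD S'D] := sector_chamber sS'.
have [d [Ed dS] dD] := S'S D S'D; exists d; split=> //; last by rewrite dD.
have [d' cd' d'D] : exists2 d', chamber E d' & D = iota @` d'.
  by apply: (chart_chamberP chart_iota) cD; rewrite -dD; exists d.
have -> // : d = d'.
apply: (iso_image_inj complex_down isoA Ed cd'.1); by rewrite dD.
Qed.

(** A chart inverting [rho] at [D] agrees with [iota] on some alcove of the sector, hence has the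
    types of [iota] everywhere. *)
Lemma rho_typed (T : Type) (tau : bpoint X -> T) : labelling K tau -> typed tau iota rho.
Proof.
move=> labtau D x cD.
have [g [e [S' [[cg ce -> gP] [sS' S'S gS']]]]] :=
  rho_chart (sector_iota weylC0) (sector_of_sub subC0) cD.
have [d [cd dC0 S'd]] := sector_of_chamber weylC0 sS' S'S.
move=> [u eu <-]; have Eu := chamber_vertex ce eu; rewrite gP //.
exact/esym/(chart_type chart_iota labtau cg chart_iota cd (gS' d cd.1 S'd)).
Qed.

(* In the folded case, suppose that two further alcoves D1, D2 on the lifted
   panel were both retracted to the other alcove e1 on s. Charts g1, g2 through
   D1, D2 share an alcove iota @` d of the sector, which lies on the side of e1;
   a shortest gallery from e1 to d, transported by g2 and retracted from D1,
   joins c to d, although d is further from c than from e1. *)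
Lemma lift_step D c s e : chamber K D -> rho @` D = c -> chamber E e ->
  panel_of c s -> panel_of e s -> (e = c -> separates phi (affine_span s) e C) ->
  exists t D', [/\ chamber K D', panel_of D t, panel_of D' t, D' <> D
    & rho @` t = s /\ rho @` D' = e].
Proof.
move=> cD rD ce pcs pes folded.
have [g [c' [_ [[cg cc' DE gP] _]]]] :=
  rho_chart (sector_iota weylC0) (sector_of_sub subC0) cD.
have c'c : c' = c by rewrite -rD DE (section_image gP cc'.1).
rewrite {}c'c in cc' DE.
have Es := panel_simplex cc' pcs.
have isog := chart_iso cg.
have pD : panel_of D (g @` s) by rewrite DE; exact: (iso_panel complex_down isog cc'.1).
have rt : rho @` (g @` s) = s by exact: section_image gP Es.
have [ec|nec] := pselect (e = c); last first.
  exists (g @` s), (g @` e); split=> //.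
  - exact: chart_chamber.
  - exact: (iso_panel complex_down isog ce.1).
  - by move=> /[!DE] /(iso_image_inj complex_down isog ce.1 cc'.1).
  - by rewrite (section_image gP ce.1).
have [S [a [k [wS [T1 [wT1 T1S T1C]] ra spanE sides]]]] := folded ec.
apply: contrapT => nolift.
have far D' : chamber K D' -> panel_of D' (g @` s) -> D' <> D -> rho @` D' <> c.
  move=> cD' pD' D'D rD'; apply: nolift; exists (g @` s), D'; split=> //.
  by rewrite ec.
have [D1 [D2 [[cD1 pD1] [cD2 pD2] [D1D D2D D12]]]] := building_thick cD pD.
have [g1 [e1 [S1 [[cg1 ce1 D1E g1P] [sS1 S1T1 g1S1]]]]] :=
  rho_chart (sector_iota wT1) (sector_of_sub T1C) cD1.
(* Applied inside [S1] rather than [T1], so that every alcove of [S2] is fixed by both charts. *)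
have [g2 [e2 [S2 [[cg2 ce2 D2E g2P] [sS2 S2S1 g2S2]]]]] :=
  rho_chart sS1 (subset_trans S1T1 (sector_of_sub T1C)) cD2.
have [d [cd dT1 S2d]] := sector_of_chamber wT1 sS2 (subset_trans S2S1 S1T1).
have ag1 := g1S1 d cd.1 (S2S1 _ S2d).
have ag2 := g2S2 d cd.1 S2d.
have e1E : rho @` D1 = e1 by rewrite D1E (section_image g1P ce1.1).
have e2E : rho @` D2 = e2 by rewrite D2E (section_image g2P ce2.1).
have pe1 : panel_of e1 s by rewrite -e1E -rt; exact: (folding_panel rho_folding).
have pe2 : panel_of e2 s by rewrite -e2E -rt; exact: (folding_panel rho_folding).
have e1c : e1 <> c by rewrite -e1E; exact: far.
have e2c : e2 <> c by rewrite -e2E; exact: far.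
have e12 : e2 = e1 by exact: (thin cc' ce2 ce1 pcs pe2 pe1).
rewrite {}e12 in D2E {ce2 e2E pe2 e2c}.
have sH : s `<=` hyperplane phi a k.
  rewrite -spanE => u su; exists 1%N, (fun=> u), (fun=> 1).
  by rewrite !big_ord1 scale1r.
have csides : c `<=` half_le phi a k /\ d `<=` half_ge phi a k \/
    c `<=` half_ge phi a k /\ d `<=` half_le phi a k.
  have dS : d `<=` S by exact: subset_trans T1S.
  rewrite ec in sides.
  by case: sides => -[Sa ca]; [left|right]; split=> //; exact: subset_trans Sa.
have [l [lp le lmin]] := gallery_across_wall (panels_shared_complex chart_iota)
  cc' cd ce1 pcs pe1 e1c ra sH csides.
have [r rP] := retraction_exists chart_iota cg1 ce1.
have fr := centered_folding cg1 ce1 rP.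
have rg1 : forall u, vertices E u -> r (g1 u) = u by exact: rP.
have g1s : g1 @` s = g @` s.
  rewrite -[s in LHS]rt; apply: (section_retract g1P ce1); rewrite -D1E.
  exact: panel_sub.
(* Only [D1] retracts onto the center [e1], so [D2] goes to the other alcove on [s]. *)
have rD2 : r @` D2 = c.
  have rD2e : r @` D2 <> e1.
    by apply: (centered_neq cg1 ce1 rP cD2); rewrite -D1E; exact: nesym.
  apply: (thin ce1 (folding_chamber fr cD2) cc' pe1 _ pcs) => //; last exact: nesym.
  rewrite -(section_image rg1 Es) g1s; exact: folding_panel.
have lp2 : gallery_path K D2 (map_path g2 l) by rewrite D2E; exact: chart_path.
have lpr : gallery_path E c (map_path r (map_path g2 l)).
  by rewrite -[c in gallery_path E c]rD2; exact: folding_path.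
have ler : gallery_end c (map_path r (map_path g2 l)) = d.
  rewrite -[c in gallery_end c]rD2 D2E !map_path_end le.
  rewrite (agree_image ag2) // -(agree_image ag1) //.
  exact: section_image rg1 cd.1.
by have := lmin _ lpr ler; rewrite !size_map_path ltnn.
Qed.

Lemma lift_path D c l : chamber K D -> rho @` D = c -> gallery_path E c l ->
  all_steps (fun c s d => d = c -> separates phi (affine_span s) d C) c l ->
  exists l', [/\ gallery_path K D l', nonstuttering D l' & map_path rho l' = l].
Proof.
elim: l D c => [|[s e] l IH] D c cD rD /=; first by exists [::].
move=> [ce pcs pes lp] [folded lf].
have [t [D' [cD' pDt pD't D'D [rt rD']]]] := lift_step cD rD ce pcs pes folded.
have [l' [l'p l'n l'E]] := IH D' e cD' rD' lp lf.
by exists ((t, D') :: l'); split=> //=; rewrite rt rD' l'E.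
Qed.

End RetractionAtInfinity.

Theorem proposition3p3 (R : realType) (n : nat) (phi : root_system R n)
  (irr : irreducible_root_system phi)
  (alpha : n.-tuple 'rV[R]_n) (balpha : root_basis phi alpha)
  (X : affine_building phi)
  (T : Type) (tau : bpoint X -> T) (labtau : labelling (@bsimplex _ _ _ X) tau)
  (A : set (set (bpoint X))) (aptA : apartment A)
  (iota : 'rV[R]_n -> bpoint X) (isoA : complex_iso (coxeter_complex phi) A iota)
  (rho : bpoint X -> 'rV[R]_n)
  (retr : retraction_at_infinity A iota (opposite_chamber phi alpha) rho)
  (x xplus : 'rV[R]_n) (spx : special_vertex phi x)
  (orbx : exists2 w, spherical_weyl phi w & xplus = w x)
  (domx : fundamental_chamber phi alpha xplus)
  (delta : gallery (bpoint X)) (mindelta : minimal_gallery (@bsimplex _ _ _ X) delta)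
  (srcdelta : gsource delta = iota 0) (tgtdelta : gtarget delta = iota xplus)
  (gamma : gallery 'rV[R]_n) (galgamma : is_gallery (coxeter_complex phi) gamma)
  (srcgamma : gsource gamma = 0)
  (typegamma : gtype tau (gallery_map iota gamma) = gtype tau delta)
  (typetarget : tau (iota (gtarget gamma)) = tau (gtarget delta))
  (foldgamma : positively_folded phi (opposite_chamber phi alpha) gamma) :
  exists gamma' : gallery (bpoint X),
    [/\ minimal_gallery (@bsimplex _ _ _ X) gamma',
        gsource gamma' = iota 0
      & gallery_map rho gamma' = gamma].
Proof.
have [C0 weylC0 subC0] := opposite_weyl_chamber balpha.
have ci := chart_iota aptA isoA.
have rhoi := rho_iota aptA isoA retr weylC0 subC0.
have rhof := rho_folding aptA isoA retr weylC0 subC0.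
have rhot := rho_typed aptA isoA retr weylC0 subC0 labtau.
have [g [c [lE [u0 [u1 [[cg cc lEp] [[cu0 eu1 gu0 gu1 minE] types]]]]]]] :=
  minimal_gallery_chart labtau ci mindelta.
have /is_galleryP[cgam hs ht gp] := galgamma.
have cD := chart_chamber ci cgam.
have rD : rho @` (iota @` ghead gamma) = ghead gamma by exact: section_image rhoi cgam.1.
have folds : all_steps
    (fun c s d => d = c -> separates phi (affine_span s) d (opposite_chamber phi alpha))
    (ghead gamma) (gsteps gamma).
  by apply/all_stepsP => i il /(foldgamma i il)[].
have [l [lp ln lE']] := lift_path aptA isoA retr weylC0 subC0 cD rD gp folds.
(* The model [lE] of [delta] in E is placed at the first alcove of the lift, with its types
   preserved. *)
have [f [cf fc ft]] := chart_transport ci labtau cg cc cD.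
have [p ep rp] : (rho @` gallery_end (iota @` ghead gamma) l) (gtarget gamma).
  by rewrite -map_path_end lE' rD.
pose gamma' := Gallery (iota 0) (iota @` ghead gamma) l p.
have D0 : (iota @` ghead gamma) (iota 0) by exists 0 => //; rewrite -srcgamma.
have isg : is_gallery (@bsimplex _ _ _ X) gamma' by apply/is_galleryP.
have Eu0 := chamber_vertex cc cu0.
have Eu1 := chamber_vertex (gallery_end_chamber cc lEp) eu1.
exists gamma'; split=> //; last first.
  rewrite /gallery_map /= rhoi; last by rewrite -srcgamma; exact: chamber_vertex hs.
  rewrite rD rp -/(map_path rho l) lE' -srcgamma.
  by case: (gamma).
apply: (same_type_minimal labtau cf cc lEp cu0 eu1 minE isg) => //=.
(* Both [f u0] and [iota 0] are vertices of the first alcove of the lift and have the type of the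
   source of [delta], so they coincide. *)
- apply: (type_inj labtau cD) => //; first by rewrite -fc; exists u0.
  by rewrite ft // gu0 srcdelta.
- case: typegamma => _; rewrite -types => typegamma.
  rewrite -(typed_path rhot cD lp) lE'.
  rewrite (same_type_path ft cc lEp) -typegamma /unzip1 -!map_comp.
  by apply: eq_map => -[].
- by rewrite ft // gu1 -typetarget -rp (rhot _ _ (gallery_end_chamber cD lp) ep).
Qed.
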